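(* Let $\mathcal Y,\mathcal U,\mathcal V$ be separable Hilbert spaces, let $\nu\in\mathbb P(\mathcal Y\times\mathcal U)$ with $\mathcal Y$-marginal $\nu_{\mathcal Y}$, let $\eta_{\mathcal V}\in\mathbb P(\mathcal V)$, and set $\eta=\nu_{\mathcal Y}\otimes\eta_{\mathcal V}\in\mathbb P(\mathcal Y\times\mathcal V)$. Let $c:(\mathcal Y\times\mathcal V)\times(\mathcal Y\times\mathcal U)\to\mathbb R$ be continuous with $\inf c>-\infty$, and suppose that the infimum $$\inf_{\pi\in\Pi_{\mathcal Y}(\eta,\nu)}K(\pi),\qquad K(\pi)=\int_{\mathcal Y\times\mathcal V\times\mathcal Y\times\mathcal U}c(z,v;y,u)\,\mathrm d\pi(z,v;y,u),\tag{K}$$ is finite. Then: (i) Problem (K) admits a minimizer $\pi^\star\in\mathbb P(\mathcal Y\times\mathcal V\times\mathcal Y\times\mathcal U)$. (ii) This $\pi^\star$ satisfies $\pi^\star(z,v,u\mid y)=\pi^\star(v,u\mid y)\,\delta(y-z)$, where for $\nu_{\mathcal Y}$-a.e. $y\in\mathcal Y$ the conditional measure $\pi^\star(\cdot,\cdot\mid y)\in\mathbb P(\mathcal V\times\mathcal U)$ is optimal for $$\inf_{\pi\in\Pi(\eta_{\mathcal V},\nu(\cdot\mid y))}\int_{\mathcal V\times\mathcal U}c(y,v;y,u)\,\mathrm d\pi(v,u).$$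
   Context: $\mathbb P(\mathcal X)$ denotes the Borel probability measures on $\mathcal X$. For Borel probability measures $\alpha,\beta$, $\Pi(\alpha,\beta)$ is the set of couplings of $\alpha$ and $\beta$ (probability measures on the product space with first marginal $\alpha$ and second marginal $\beta$). $\nu(\cdot\mid y)\in\mathbb P(\mathcal U)$ denotes the (regular) conditional measure of $\nu$ given the $\mathcal Y$-coordinate $y$, which is $\nu_{\mathcal Y}$-a.e. unique. The constrained set of couplings is $$\Pi_{\mathcal Y}(\eta,\nu)=\{\pi\in\Pi(\eta,\nu):\ (z,v;y,u)\sim\pi \text{ satisfies } z=y \text{ almost surely}\},$$ where $(z,v)\in\mathcal Y\times\mathcal V$ and $(y,u)\in\mathcal Y\times\mathcal U$. The notation in (ii) means that, disintegrating $\pi^\star$ along the variable $y$, the conditional law of $(z,v,u)$ given $y$ is the product of a Dirac mass at $z=y$ and the measure $\pi^\star(\mathrm dv,\mathrm du\mid y)$. *)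

(* Defs.v *)
From HB Require Import structures.
From mathcomp Require Import all_boot all_order all_algebra.
From mathcomp Require Import sesquilinear.
From mathcomp Require Import all_classical all_reals all_analysis.
From mathcomp Require Import measurable_realfun.

Set Implicit Arguments.
Unset Strict Implicit.
Unset Printing Implicit Defensive.
Import Order.TTheory GRing.Theory Num.Theory.
Import numFieldNormedType.Exports.
Local Open Scope classical_set_scope.
Local Open Scope ring_scope.

Definition is_hilbert (R : realType) (H : completeNormedModType R) :=
  exists ip : {dot H for idfun}, forall x : H, ip x x = `|x| ^+ 2.

Definition separable (T : topologicalType) :=
  exists2 D : set T, countable D & dense D.

Notation borel T := (g_sigma_algebraType (@open T)).

(* On products we use the product of the Borel sigma-algebras; for separable
   spaces it is the Borel sigma-algebra of the product topology, as proved in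
   [measurable_borel2] and [measurable_borel4]. *)

Lemma separable_second_countable (R : realType) (H : normedModType R) :
  separable H -> @second_countable H.
Proof.
move=> [D cD dD].
pose f (p : H * nat) : set H := ball p.1 p.2.+1%:R^-1.
exists (f @` (D `*` [set: nat])).
  by apply: sub_countable (card_image_le _ _) _; exact: countableX.
split; first by move=> _ [p _ <-]; exact: ball_open.
move=> x A /nbhs_ballP[e /= e0 xeA].
have e20 : 0 < e / 2 by rewrite divr_gt0.
have [n ne] : exists n : nat, n.+1%:R^-1 < e / 2 :> R.
  have [N _ /(_ N)/(_ (leqnn _)) ?] := near_infty_natSinv_lt (PosNum e20).
  by exists N.
have n0 : 0 < n.+1%:R^-1 :> R by rewrite invr_gt0.
have [||d [xd Dd]] := dD (ball x n.+1%:R^-1).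
- by exists x; exact: ballxx.
- exact: ball_open.
exists (f (d, n)).
  by split; [exists (d, n)|exact: ball_sym].
move=> z dz; apply: xeA; rewrite (splitr e).
by apply: (@ball_triangle _ _ d); apply: le_ball (ltW ne) _ _.
Qed.

Lemma second_countable_prod (T1 T2 : topologicalType) :
  @second_countable T1 -> @second_countable T2 -> @second_countable (T1 * T2)%type.
Proof.
move=> [B1 cB1 [oB1 bB1]] [B2 cB2 [oB2 bB2]].
exists ((fun p => p.1 `*` p.2) @` (B1 `*` B2)).
  by apply: sub_countable (card_image_le _ _) _; exact: countableX.
split.
  move=> _ [[A B] [/= /oB1 oA /oB2 oB] <-].
  rewrite openE => -[x y] /= [Ax By]; exists (A, B) => //; split => /=.
    exact: open_nbhs_nbhs.
  exact: open_nbhs_nbhs.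
move=> [x y] O [[P Q] /= [xP yQ] PQO].
have [A [BA Ax] AP] := bB1 x P xP.
have [B [BB By] BQ] := bB2 y Q yQ.
exists (A `*` B); first by split=> //; exists (A, B).
by move=> [a b] [/= Aa Bb]; apply: PQO; split; [exact: AP|exact: BQ].
Qed.

Lemma sigma_algebra_bigcup_countable (T I : Type) (G : set (set T))
    (D : set I) (F : I -> set T) : countable D ->
  (forall i, D i -> <<s G >> (F i)) -> <<s G >> (\bigcup_(i in D) F i).
Proof.
move=> /pfcard_geP[->|[f]] mF; first by rewrite bigcup_set0; exact: sigma_algebra0.
rewrite (_ : \bigcup_(i in D) F i = \bigcup_n F (f n)); last first.
  rewrite eqEsubset; split=> [x [i Di Fi]|x [n _ Fn]].
    have Df : set_surj [set: nat] D f by exact: surj.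
    by have [n _ ni] := Df _ Di; exists n => //; rewrite ni.
  by exists (f n) => //; exact: funS.
by apply: sigma_algebra_bigcup => n; apply: mF; exact: funS.
Qed.

Lemma preimage_borel (T1 T2 : topologicalType) (f : T1 -> T2) (A : set T2) :
  continuous f -> <<s @open T2 >> A -> <<s @open T1 >> (f @^-1` A).
Proof.
move=> cf.
suff: <<s @open T2 >> `<=` [set X : set T2 | <<s @open T1 >> (f @^-1` X)].
  exact.
apply: smallest_sub; last first.
  by move=> X oX; apply: sub_sigma_algebra; move/continuousP : cf; exact.
split => /=.
- by rewrite preimage_set0; exact: sigma_algebra0.
- by move=> X sX; rewrite setTD preimage_setC -setTD; exact: sigma_algebraCD.
- by move=> F sF; rewrite preimage_bigcup; exact: sigma_algebra_bigcup.
Qed.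

Lemma borel_prod (T1 T2 : topologicalType) :
  @second_countable T1 -> @second_countable T2 ->
  <<s [set A `*` B | A in <<s @open T1 >> & B in <<s @open T2 >>] >> =
  <<s @open (T1 * T2)%type >>.
Proof.
move=> [B1 cB1 [oB1 bB1]] [B2 cB2 [oB2 bB2]].
rewrite eqEsubset; split.
  apply: smallest_sub; first exact: smallest_sigma_algebra.
  move=> _ [A mA [B mB <-]].
  have sI : setI_closed <<s @open (T1 * T2)%type >>.
    by have [_ _ _] := (sigma_algebraP (fun X _ => @subsetT _ X)).1
      (smallest_sigma_algebra [set: T1 * T2] open).
  have := sI (fst @^-1` A) (snd @^-1` B); apply.
  - by apply: preimage_borel => // x; exact: cvg_fst.
  - by apply: preimage_borel => // x; exact: cvg_snd.
apply: smallest_sub; first exact: smallest_sigma_algebra.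
move=> O oO.
pose I := [set p | (B1 `*` B2) p /\ p.1 `*` p.2 `<=` O].
have -> : O = \bigcup_(p in I) (p.1 `*` p.2).
  rewrite eqEsubset; split; last by move=> x [p [_ pO] px]; exact: pO.
  move=> [x y] Oxy; have := open_nbhs_nbhs (conj oO Oxy).
  move=> [[P Q] /= [xP yQ] PQO].
  have [A [BA Ax] AP] := bB1 x P xP.
  have [B [BB By] BQ] := bB2 y Q yQ.
  exists (A, B) => //; split=> //=.
  by move=> [a b] [/= Aa Bb]; apply: PQO; split; [exact: AP|exact: BQ].
apply: sigma_algebra_bigcup_countable.
  by apply: sub_countable (countableX cB1 cB2); apply: subset_card_le => p [].
move=> [A B] [[/= /oB1 oA /oB2 oB] _].
by apply: sub_sigma_algebra; exists A; [|exists B]; rewrite //;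
  exact: sub_sigma_algebra.
Qed.

Lemma measurable_borel2 (T1 T2 : ptopologicalType) :
  @second_countable T1 -> @second_countable T2 ->
  @measurable _ (borel T1 * borel T2)%type = <<s @open (T1 * T2)%type >>.
Proof. by move=> s1 s2; rewrite measurable_prod_measurableType borel_prod. Qed.

Lemma measurable_borel4 (T1 T2 T3 T4 : ptopologicalType) :
  @second_countable T1 -> @second_countable T2 ->
  @second_countable T3 -> @second_countable T4 ->
  @measurable _ ((borel T1 * borel T2) * (borel T3 * borel T4))%type =
  <<s @open ((T1 * T2) * (T3 * T4))%type >>.
Proof.
move=> s1 s2 s3 s4.
rewrite measurable_prod_measurableType !measurable_borel2// borel_prod//;
  exact: second_countable_prod.
Qed.

Section coordinates.
Context d1 d2 (T1 : measurableType d1) (T2 : measurableType d2).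
HB.instance Definition _ := isMeasurableFun.Build (d1, d2).-prod%mdisp d1
  (T1 * T2)%type T1 fst measurable_fst.
HB.instance Definition _ := isMeasurableFun.Build (d1, d2).-prod%mdisp d2
  (T1 * T2)%type T2 snd measurable_snd.
End coordinates.

Definition couplings d1 d2 (T1 : measurableType d1) (T2 : measurableType d2)
    (R : realType) (alpha : probability T1 R) (beta : probability T2 R) :
    set (probability (T1 * T2)%type R) :=
  [set pi |
    (forall A, measurable A -> distribution pi fst A = alpha A) /\
    (forall B, measurable B -> distribution pi snd B = beta B)].

(* A point [x] stands for [((z, v), (y, u))], so the constraint is [z = y]. *)
Definition constrained_couplings dY dV dU (Y : measurableType dY)
    (V : measurableType dV) (U : measurableType dU) (R : realType)
    (eta : probability (Y * V)%type R) (nu : probability (Y * U)%type R) :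
    set (probability ((Y * V) * (Y * U))%type R) :=
  [set pi | couplings eta nu pi /\ {ae pi, forall x, x.1.1 = x.2.1}].

Definition is_minimizer (T : Type) (R : realType) (S : set T)
    (J : T -> \bar R) (x : T) :=
  S x /\ J x = ereal_inf (J @` S).

(* [k] is a version of the regular conditional law of [Z] given [X] under the
   probability [P]; [X] and [Z] are meant to be measurable. *)
Definition is_cond_law dT dS dW (T : measurableType dT) (S : measurableType dS)
    (W : measurableType dW) (R : realType) (P : probability T R)
    (X : T -> S) (Z : T -> W) (k : S -> probability W R) :=
  (forall B, measurable B -> measurable_fun [set: S] (k ^~ B)) /\
  (forall A B, measurable A -> measurable B ->
    P (X @^-1` A `&` Z @^-1` B) = (\int[pushforward P X]_(s in A) k s B)%E).

(* Main.v *)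
(* After adding a constant, c >= 0.  A nonnegative continuous cost on second
   countable spaces is the increasing limit of costs f_k that are constant on the
   cells of a finite measurable product partition.  For f_k the problem in the
   fiber over y is a finite transport problem, for which a 1/(k+1)-optimal plan can
   be selected measurably in y among countably many candidates; let psi_k(y) be its
   cost and m(y) the supremum over k of max(0, psi_k(y) - 1/(k+1)).  Then m(y)
   bounds from below the cost of every coupling in the fiber over y, so the
   integral of m bounds (K) from below.

   Conversely, gluing the selected plans gives global couplings, and an ultrafilter
   limit of these, taken set by set on rectangles, is countably additive in each
   variable because the marginals do not move; it extends to a measure by
   disintegration along a Cantor space.  Since f_l <= f_k for l <= k, its cost is at
   most the integral of m.  So the infimum is the integral of m and is attained, and
   the fiber cost of any minimizer, being at least m and of the same finite
   integral, equals m almost everywhere. *)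
Require Import Defs.
From HB Require Import structures.
From mathcomp Require Import all_boot all_order all_algebra.
From mathcomp Require Import all_classical all_reals all_analysis.
From mathcomp Require Import measurable_realfun ring lra.

Set Implicit Arguments.
Unset Strict Implicit.
Unset Printing Implicit Defensive.
Import Order.TTheory GRing.Theory Num.Theory.
Import numFieldNormedType.Exports.
Local Open Scope classical_set_scope.
Local Open Scope ring_scope.

(** * Conditional laws and integration *)

(** No weak topology and no tightness enter. Taking limits on rectangles only loses nothing, because
    each f_l is a finite combination of indicators of rectangles; what such a limit could lose is
    countable additivity. Passing from two one-variable measures to a measure on the product needs a
    kernel, and on the Cantor space a probability is just a consistent family of weights on
    countably many cylinders, so the exceptional null sets can be discarded together.

    The value of the fiber problem is not known beforehand to be measurable in y. The function m is
    a measurable substitute, built from countably many candidates, and it is seen to be the fiber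
    optimum almost everywhere only at the end. The glued plans live on (Y x U) x V, with y stored
    once: the factor Y x U then keeps the law nu, and the constraint z = y holds by construction
    once y is copied. *)

Definition law {d d'} {T : measurableType d} {S : measurableType d'}
    {R : realType} (P : probability T R) (f : T -> S)
    (mf : measurable_fun [set: T] f) : probability S R :=
  distribution P (mfun_Sub (mem_set mf)).

(** Dynkin's pi-lambda argument. Finite mass lets complements be subtracted; equality of the total
    masses is asked separately because [G] need not contain the whole space. *)
Lemma eq_finite_measure {d} {T : measurableType d} {R : realType}
    (G : set (set T)) (m1 m2 : {measure set T -> \bar R}) :
  @measurable _ T = <<s G >> -> setI_closed G ->
  (m1 setT < +oo)%E -> m1 setT = m2 setT ->
  (forall A, G A -> m1 A = m2 A) -> forall A, measurable A -> m1 A = m2 A.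
Proof.
move=> GE GI m1oo m12T m12 A; rewrite GE.
apply: (@dynkin_induction _ _ G (fun A => m1 A = m2 A)) => //.
- move=> S mS h.
  have fS (m : {measure set T -> \bar R}) : (m setT < +oo)%E ->
      m (~` S) = (m setT - m S)%E.
    by move=> moo; rewrite -setTD measureD// setTI.
  by rewrite !fS// -?m12T// h.
- move=> F mF tF h; rewrite !measure_bigcup//.
  by apply: eq_eseriesr => i _; exact: h.
Qed.

Lemma measurable_kernel_generator {d d'} {X : measurableType d}
    {T : measurableType d'} {R : realType} (G : set (set T))
    (k : X -> probability T R) :
  @measurable _ T = <<s G >> -> setI_closed G ->
  (forall A, G A -> measurable_fun [set: X] (k ^~ A)) ->
  forall A, measurable A -> measurable_fun [set: X] (k ^~ A).
Proof.
move=> GE GI kG A; rewrite GE.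
apply: (@dynkin_induction _ _ G (fun A => measurable_fun [set: X] (k ^~ A))) => //.
- under eq_fun do rewrite probability_setT; exact: measurable_cst.
- move=> S mS h; under eq_fun do rewrite probability_setC//.
  exact: emeasurable_funB.
- move=> F mF tF h; under eq_fun do rewrite measure_bigcup//.
  by apply: ge0_emeasurable_sum => // i _; exact: h.
Qed.

Section probability_of_measure.
Context {d} {T : measurableType d} {R : realType}.
Variable m : {measure set T -> \bar R}.
Hypothesis m1 : m setT = 1%E.

Let p : set T -> \bar R := m.
#[local] HB.instance Definition _ := Measure.on p.
#[local] HB.instance Definition _ := Measure_isProbability.Build _ _ _ p m1.

Lemma probability_of_measure :
  exists P : probability T R, forall A, P A = m A.
Proof. by exists p. Qed.

End probability_of_measure.

Lemma mixture_measure {d d'} {X : measurableType d} {W : measurableType d'}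
    {R : realType} (mu : {measure set X -> \bar R}) (k : X -> probability W R)
    (B : set X) :
  measurable B ->
  (forall A, measurable A -> measurable_fun [set: X] (k ^~ A)) ->
  exists m : {measure set W -> \bar R},
    forall A, m A = (\int[mu]_(x in B) k x A)%E.
Proof.
move=> mB mk; pose m A := (\int[mu]_(x in B) k x A)%E.
have m0 : m set0 = 0%E by rewrite /m integral0_eq.
have mge0 A : (0 <= m A)%E by exact: integral_ge0.
have ms : semi_sigma_additive m.
  move=> F mF tF mUF.
  rewrite (_ : m _ = (\int[mu]_(x in B) \sum_(n <oo) k x (F n))%E); last first.
    apply: eq_integral => s _; rewrite measure_bigcup//.
    by apply: eq_eseriesl => n; rewrite in_setT.
  rewrite integral_nneseries//; last first.
    by move=> n; apply: measurable_funTS; exact: mk.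
  by apply: (@is_cvg_nneseries R (fun n => m (F n)) predT 0%N) => n _ _.
pose M : {measure set W -> \bar R} :=
  HB.pack m (isMeasure.Build _ _ _ m m0 mge0 ms).
by exists M.
Qed.

Lemma density_probability {d} {T : measurableType d} {R : realType}
    (P : probability T R) (f : T -> \bar R) :
  measurable_fun [set: T] f -> (forall x, (0 <= f x)%E) ->
  (\int[P]_x f x = 1)%E ->
  exists Q : probability T R,
    forall A, measurable A -> Q A = (\int[P]_(x in A) f x)%E.
Proof.
move=> mf f0 f1; pose m A := (\int[P]_(x in A) f x)%E.
have m0 : m set0 = 0%E by rewrite /m integral_set0.
have mge0 A : (0 <= m A)%E by exact: integral_ge0.
have ms : semi_sigma_additive m.
  move=> F mF tF mUF; rewrite /m ge0_integral_bigcup//; last first.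
    exact: measurable_funTS.
  by apply: (@is_cvg_nneseries R (fun n => m (F n)) predT 0%N) => n _ _.
pose M : {measure set T -> \bar R} :=
  HB.pack m (isMeasure.Build _ _ _ m m0 mge0 ms).
have [Q QM] := @probability_of_measure _ _ _ M f1.
by exists Q => A mA; rewrite QM.
Qed.

Section cond_law.
Context {dT dS dW} {T : measurableType dT} {S : measurableType dS}
  {W : measurableType dW} {R : realType}.
Variables (P : probability T R) (X : T -> S) (Z : T -> W).
Variable k : S -> probability W R.
Hypothesis mX : measurable_fun [set: T] X.
Hypothesis mZ : measurable_fun [set: T] Z.
Hypothesis kP : is_cond_law P X Z k.

Let ker (s : S) : {measure set W -> \bar R} := k s.

#[local] HB.instance Definition _ := @isKernel.Build _ _ _ _ _ ker kP.1.
#[local] HB.instance Definition _ :=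
  @Kernel_isProbability.Build _ _ _ _ _ ker (fun s => probability_setT (k s)).

(** [kcomp] composes a kernel into [S] with one out of a product with [S], so the law of [X] is
    recast as a constant kernel on a one-point space. *)
Let base (u : unit) : {measure set S -> \bar R} := law P mX.

Let mbase U : measurable U -> measurable_fun [set: unit] (base ^~ U).
Proof. by move=> _; exact: measurable_cst. Qed.

#[local] HB.instance Definition _ := @isKernel.Build _ _ _ _ _ base mbase.
#[local] HB.instance Definition _ := @Kernel_isProbability.Build _ _ _ _ _ base
  (fun s => probability_setT (law P mX)).

(** Keeping [s] beside [w] makes the composition with [base] the joint law of [X] and [Z] rather
    than the law of [Z] alone. *)
Let graph (us : unit * S) : {measure set (S * W) -> \bar R} :=
  law (k us.2) (measurable_pair1 us.2).

Lemma measurable_cond_law_xsection (A : set (S * W)) : measurable A ->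
  measurable_fun [set: S] (fun s => k s (xsection A s)).
Proof.
by move=> mA; apply: (@measurable_fun_xsection_finite_kernel _ _ _ _ _ ker);
  rewrite inE.
Qed.

Lemma measurable_cond_law_integral (h : S * W -> \bar R) :
  measurable_fun [set: S * W] h -> (forall x, (0 <= h x)%E) ->
  measurable_fun [set: S] (fun s => \int[k s]_w h (s, w))%E.
Proof.
by move=> mh h0; exact: (measurable_fun_integral_finite_kernel h ker).
Qed.

Let mgraph U : measurable U -> measurable_fun [set: unit * S] (graph ^~ U).
Proof.
move=> mU.
have := measurableT_comp (measurable_cond_law_xsection mU)
  (@measurable_snd _ _ unit S).
apply: eq_measurable_fun => -[u s] _ /=.
by rewrite /graph/= /law/= /distribution/= /pushforward xsectionE.
Qed.

#[local] HB.instance Definition _ := @isKernel.Build _ _ _ _ _ graph mgraph.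
#[local] HB.instance Definition _ := @Kernel_isProbability.Build _ _ _ _ _ graph
  (fun us => probability_setT (law (k us.2) (measurable_pair1 us.2))).

Let XZ (t : T) := (X t, Z t).
Let mXZ : measurable_fun [set: T] XZ.
Proof. exact: measurable_fun_pair. Qed.

(** Both sides are probabilities and rectangles are a generator stable under intersection; on a
    rectangle the identity is the defining property of a conditional law. *)
Let joint A : measurable A -> law P mXZ A = kcomp base graph tt A.
Proof.
pose G := [set A `*` B | A in @measurable _ S & B in @measurable _ W].
move=> mA; apply: (@eq_finite_measure _ _ _ G (law P mXZ) (mkcomp base graph tt)) => //.
- exact: measurable_prod_measurableType.
- move=> _ _ [A1 mA1 [B1 mB1 <-]] [A2 mA2 [B2 mB2 <-]].
  exists (A1 `&` A2); first exact: measurableI.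
  by exists (B1 `&` B2); [exact: measurableI|rewrite setXI].
- by rewrite (_ : _ [set: _] = 1%E) ?ltry//; exact: (probability_setT (law P mXZ)).
- apply: (eq_trans (probability_setT (law P mXZ))); apply/esym.
  rewrite -[LHS]/(\int[base tt]_y graph (tt, y) setT)%E.
  rewrite (eq_integral (cst 1%E)); last first.
    by move=> s _; exact: (probability_setT (law (k s) _)).
  by rewrite integral_cst// mul1e; exact: (probability_setT (law P mX)).
move=> _ [A1 mA1 [B1 mB1 <-]].
rewrite /mkcomp/= /kcomp/= /law/= /distribution/= /pushforward.
transitivity (P (X @^-1` A1 `&` Z @^-1` B1)); first by [].
rewrite kP.2// integral_mkcond; apply: eq_integral => s _.
rewrite patchE /graph /law /distribution /= /pushforward /=.
case: ifPn => sA1.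
  congr (k s _); apply/seteqP; split=> w //=; last by case.
  by move=> ?; split=> //; rewrite inE in sA1.
rewrite (_ : _ @^-1` _ = set0) ?measure0//.
by apply/seteqP; split=> w //= -[]; rewrite notin_setE in sA1.
Qed.

Lemma integral_cond_law (h : S * W -> \bar R) :
  measurable_fun [set: S * W] h -> (forall x, (0 <= h x)%E) ->
  (\int[P]_t h (X t, Z t) = \int[pushforward P X]_s \int[k s]_w h (s, w))%E.
Proof.
move=> mh h0.
transitivity (\int[law P mXZ]_x h x)%E.
  by rewrite /law /distribution ge0_integral_pushforward//= preimage_setT.
rewrite (eq_measure_integral (mkcomp base graph tt)); last first.
  by move=> A mA _; exact: joint.
have := @integral_kcomp _ _ _ _ _ _ R base graph tt h h0 mh.
move=> ->; apply: eq_integral => s _ /=.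
by rewrite /graph /law /distribution ge0_integral_pushforward//= preimage_setT.
Qed.

End cond_law.

(** The converse of disintegration: the measure is the mixture over [mu] of the products of a Dirac
    mass at [s] with [k s]. *)
Lemma joint_probability {dS dW} {S : measurableType dS} {W : measurableType dW}
    {R : realType} (mu : probability S R) (k : S -> probability W R) :
  (forall A, measurable A -> measurable_fun [set: S] (k ^~ A)) ->
  exists P : probability (S * W)%type R,
    (forall B, measurable B -> P (fst @^-1` B) = mu B) /\
    is_cond_law P fst snd k.
Proof.
move=> mk; pose g s : probability (S * W)%type R :=
  law (k s) (measurable_pair1 s).
have gX s B A : g s (B `*` A) = ((\1_B s)%:E * k s A)%E.
  rewrite indicE -[LHS]/(k s (pair s @^-1` (B `*` A))).
  have [sB|sB] := boolP (s \in B).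
    rewrite mul1e; congr (k s _); apply/seteqP; split=> w //=; first by case.
    by rewrite inE in sB.
  rewrite mul0e (_ : _ @^-1` _ = set0) ?measure0//.
  by apply/seteqP; split=> w //= -[]; rewrite notin_setE in sB.
have mg A : measurable A -> measurable_fun [set: S] (g ^~ A).
  pose G := [set A `*` B | A in @measurable _ S & B in @measurable _ W].
  apply: (@measurable_kernel_generator _ _ _ _ _ G).
  - exact: measurable_prod_measurableType.
  - move=> _ _ [A1 mA1 [B1 mB1 <-]] [A2 mA2 [B2 mB2 <-]].
    exists (A1 `&` A2); first exact: measurableI.
    by exists (B1 `&` B2); [exact: measurableI|rewrite setXI].
  move=> _ [B mB [{}A mA <-]].
  under eq_fun do rewrite gX.
  apply: emeasurable_funM; last exact: mk.
  by apply/measurable_EFinP; exact: measurable_indic.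
have [m mE] := mixture_measure mu measurableT mg.
have mX B A : measurable B -> measurable A ->
    m (B `*` A) = (\int[mu]_(s in B) k s A)%E.
  move=> mB mA; rewrite mE [RHS]integral_mkcond; apply: eq_integral => s _.
  by rewrite gX patchE indicE; case: ifPn => _; rewrite ?mul1e ?mul0e.
have m1 : m setT = 1%E.
  rewrite mE; under eq_integral do rewrite probability_setT.
  by rewrite integral_cst// mul1e; exact: (probability_setT mu).
have [P PE] := probability_of_measure m1.
have Pfst B : measurable B -> P (fst @^-1` B) = mu B.
  move=> mB; rewrite PE (_ : _ @^-1` _ = B `*` setT); last first.
    by apply/seteqP; split=> x //= [].
  rewrite mX//; under eq_integral do rewrite probability_setT.
  by rewrite integral_cst// mul1e.
exists P; split => //; split => // B A mB mA.
rewrite -[_ `&` _]/(B `*` A) PE mX//.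
by apply: eq_measure_integral => C mC _; rewrite -[RHS]/(P _) Pfst.
Qed.

(** * Kernels on the Cantor space *)

Definition cyl (s : seq bool) : set (nat -> bool) :=
  [set x | mkseq x (size s) = s].

(** The empty set is added so that the class is stable under intersection: two cylinders are nested
    or disjoint. *)
Definition cylinders : set (set (nat -> bool)) :=
  [set A | A = set0 \/ exists s, A = cyl s].

Notation cantor := (g_sigma_algebraType cylinders).

Lemma take_mkseq (T : Type) (x : nat -> T) m n :
  (m <= n)%N -> take m (mkseq x n) = mkseq x m.
Proof. by move=> mn; rewrite -map_take take_iota (minn_idPl mn). Qed.

Lemma setI_cylinders : setI_closed cylinders.
Proof.
have cylI s t : (size s <= size t)%N -> cylinders (cyl s `&` cyl t).
  move=> st; have [tE|tN] := eqVneq (take (size s) t) s.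
    right; exists t; rewrite setIidr// => x /= xt.
    by rewrite /cyl/= -(take_mkseq _ st) xt.
  left; apply/seteqP; split=> x //= [xs xt]; move/eqP: tN; apply.
  by rewrite -xt take_mkseq.
move=> A B [->|[s ->]] [->|[t ->]]; rewrite ?set0I ?setI0; try by left.
by have [|/ltnW] := leqP (size s) (size t); [|rewrite setIC]; exact: cylI.
Qed.

Lemma cyl_nil : cyl [::] = setT.
Proof. by apply/seteqP; split. Qed.

Lemma measurable_cyl s : measurable (cyl s : set cantor).
Proof. by apply: sub_sigma_algebra; right; exists s. Qed.

Lemma cyl_rcons s b : cyl (rcons s b) = cyl s `&` [set x | x (size s) = b].
Proof.
apply/seteqP; split=> x; rewrite /cyl/= size_rcons mkseqS.
  by move=> /rcons_inj[-> ->].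
by move=> [-> ->].
Qed.

Lemma cyl_split s : cyl s = cyl (rcons s false) `|` cyl (rcons s true).
Proof.
rewrite !cyl_rcons; apply/seteqP; split=> x; last by case=> -[].
by move=> xs; case xb : (x (size s)); [right|left].
Qed.

Lemma cyl_disjoint s : cyl (rcons s false) `&` cyl (rcons s true) = set0.
Proof. by rewrite !cyl_rcons; apply/seteqP; split=> x // -[[_ /= ->] []]. Qed.

Lemma measurable_cantor d (T : measurableType d) (f : T -> cantor) :
  (forall n, measurable_fun [set: T] (fun t => f t n)) ->
  measurable_fun [set: T] f.
Proof.
move=> mf; apply: (@measurability _ _ _ cantor _ _ cylinders) => // _ [_ [->|[s ->]] <-].
  by rewrite preimage_set0 setI0.
rewrite setTI; elim/last_ind: s => [|s b ih]; first by rewrite cyl_nil preimage_setT.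
rewrite cyl_rcons preimage_setI; apply: measurableI => //.
rewrite -[X in measurable X]setTI.
exact: (mf (size s) measurableT [set b]).
Qed.

Lemma measurable_fun_coordinate n : measurable_fun [set: cantor] (fun x => x n).
Proof.
apply: (measurable_fun_bool true); rewrite setTI.
rewrite (_ : _ @^-1` _ = \bigcup_(s : seq bool)
    (if (size s == n.+1) && last false s then cyl s else set0)).
  by apply: countable_bigcupT_measurable => // s; case: ifPn => // _;
    exact: measurable_cyl.
apply/seteqP; split=> x /=.
  move=> xn; exists (mkseq x n.+1) => //.
  by rewrite size_mkseq eqxx mkseqS last_rcons xn /cyl/= size_rcons size_mkseq mkseqS xn.
by move=> [s _]; case: ifPn => // /andP[/eqP sn sl]; rewrite /cyl/= sn mkseqS => sE;
  rewrite -sE last_rcons in sl.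
Qed.

(** * Probabilities on the Cantor space with prescribed cylinder weights *)

Section subdivision.
Context {R : realType} (q : seq bool -> R).
Hypothesis q0 : forall s, 0 <= q s.
Hypothesis q1 : q [::] = 1.
Hypothesis qD : forall s, q s = q (rcons s false) + q (rcons s true).

(* [0, 1[ is cut successively in proportion to [q]: the reals whose first bits are
   [s] form an interval [l, l + q s[, so Lebesgue measure gives it mass [q s]. *)
Fixpoint walk (t : R) n : seq bool * R :=
  if n is m.+1 then
    let: (s, l) := walk t m in
    if t < l + q (rcons s false) then (rcons s false, l)
    else (rcons s true, l + q (rcons s false))
  else ([::], 0).

Definition walk_bits t : cantor := fun n => last false (walk t n.+1).1.

Lemma mkseq_walk_bits t n : mkseq (walk_bits t) n = (walk t n).1.
Proof.
elim: n => // n ih; rewrite mkseqS ih /walk_bits /=.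
by case: (walk t n) => s l; case: ifPn => _; rewrite /= last_rcons.
Qed.

(** The induction has to carry the second component too: it is the left end from which the next cut
    is measured. If [q s] is 0 the interval is empty and no walk reaches [s]. *)
Lemma walkP s : exists l, [/\ 0 <= l, l + q s <= 1 &
  forall t, 0 <= t < 1 -> ((walk t (size s)).1 = s <-> l <= t < l + q s) /\
    ((walk t (size s)).1 = s -> (walk t (size s)).2 = l)].
Proof.
elim/last_ind: s => [|s b [l [l0 l1 ih]]].
  by exists 0; rewrite q1 add0r; split => // t t01 /=; split.
exists (if b then l + q (rcons s false) else l); split.
- by case: b => //; rewrite addr_ge0.
- case: b; first by rewrite -addrA -qD.
  by rewrite (le_trans _ l1)// lerD2l (qD s) lerDl.
move=> t t01; have {ih}[] := ih t t01; rewrite size_rcons /=.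
case: (walk t (size s)) => s' l' /= ihs ihl.
have qs := qD s; have := q0 (rcons s true); have := q0 (rcons s false).
move=> qf0 qt0.
split; last first.
  by case: ifPn => _ /= /rcons_inj[s's <-]; rewrite (ihl s's) ?s's.
split.
  case: ifPn => h /= /rcons_inj[s's <-]; have /andP[lt tl] := ihs.1 s's;
    rewrite (ihl s's) s's in h; first by rewrite lt h.
  by rewrite -leNgt in h; rewrite h -addrA -qs.
move=> h; have s's : s' = s.
  apply/ihs; move: h; case: (b) => /andP[h1 h2]; apply/andP; split => //.
  - by rewrite (le_trans _ h1)// lerDl.
  - by rewrite qs addrA.
  - by rewrite (lt_le_trans h2)// qs lerD2l lerDl.
rewrite (ihl s's) s's; move: h; case: (b) => /andP[h1 h2].
  by rewrite ltNge h1.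
by rewrite h2.
Qed.

(** Points outside [0, 1[ are sent to 0, so that [walkP] controls the walk on the whole line; [unif]
    gives them no mass. *)
Let clamp (t : R) : R := if 0 <= t < 1 then t else 0.

Let measurable_clamp : measurable_fun setT clamp.
Proof.
apply: measurable_fun_ifT => //.
by apply: measurable_and; [exact: measurable_fun_ler|exact: measurable_fun_ltr].
Qed.

Let clamp01 t : 0 <= clamp t < 1.
Proof. by rewrite /clamp; case: ifPn => //; rewrite lexx ltr01. Qed.

Let preimage_cyl s : exists l, [/\ 0 <= l, l + q s <= 1 &
  (walk_bits \o clamp) @^-1` (cyl s) = [set t | l <= clamp t < l + q s]].
Proof.
have [l [l0 l1 lP]] := walkP s; exists l; split=> //.
apply/seteqP; split=> t /=; rewrite /cyl /= mkseq_walk_bits.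
  by move/(lP _ (clamp01 t)).1.
by move=> h; apply/(lP _ (clamp01 t)).1.
Qed.

Let measurable_walk_clamp : measurable_fun setT (walk_bits \o clamp).
Proof.
apply: (@measurability _ _ _ cantor _ _ cylinders) => // _ [_ [->|[s ->]] <-].
  by rewrite preimage_set0 setI0.
have [l [_ _ ->]] := preimage_cyl s.
have mg : measurable_fun setT (fun t => l <= clamp t < l + q s).
  by apply: measurable_and; [exact: measurable_fun_ler|exact: measurable_fun_ltr].
exact: (mg measurableT [set true]).
Qed.

Let lebesgue01 : {measure set (measurableTypeR R) -> \bar R} :=
  mrestr (@lebesgue_measure R) (measurable_itv `[0, 1[).

(** The restricted measure already has mass 1; normalizing it only supplies the structure of a
    probability, and the Dirac mass is the fallback that [mnormalize] asks for. *)
Let unif : probability (measurableTypeR R) R :=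
  mnormalize lebesgue01 (@dirac _ (measurableTypeR R) 0 R).

Let unifE A : unif A = lebesgue_measure (A `&` `[0, 1[).
Proof.
have e : lebesgue01 setT = 1%E.
  by rewrite /lebesgue01/= /mrestr setTI lebesgue_measure_itv/= lte_fin ltr01
    oppr0 adde0.
by rewrite -[LHS]/(mnormalize _ _ A) /mnormalize e onee_eq0/= invr1 mule1.
Qed.

Lemma subdivision_probability :
  exists P : probability cantor R, forall s, P (cyl s) = (q s)%:E.
Proof.
exists (law unif measurable_walk_clamp) => s.
have [l [l0 l1 lP]] := preimage_cyl s.
rewrite -[LHS]/(unif (_ @^-1` _)) lP unifE.
rewrite (_ : _ `&` _ = `[l, l + q s[%classic); last first.
  apply/seteqP; split=> t /=; rewrite !in_itv/=.
    by move=> [h t01]; move: h; rewrite /clamp t01.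
  move=> /andP[lt tl]; have t01 : 0 <= t < 1.
    by rewrite (le_trans l0)//= (lt_le_trans tl).
  by rewrite /clamp t01 lt tl.
rewrite lebesgue_measure_itv/= lte_fin ltrDl; case: ltP => [_|q0'].
  by rewrite -EFinD addrAC subrr add0r.
by have -> : q s = 0 by apply/eqP; rewrite eq_le q0' q0.
Qed.

End subdivision.

(* The measure structure of [pushforward] takes the measurability proof as an
   argument, so it cannot be inferred and is named explicitly. *)
Definition mpush {d d'} {T : measurableType d} {S : measurableType d'}
    {R : realType} (m : {measure set T -> \bar R}) (f : T -> S)
    (mf : measurable_fun [set: T] f) : {measure set S -> \bar R} :=
  measure_function_pushforward__canonical__measure_function_Measure m mf.

Section bimeasure.
Context {d} {X : measurableType d} {R : realType}.
Variables (mu : probability X R) (m : seq bool -> {measure set X -> \bar R}).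
Hypothesis m_nil : forall B, measurable B -> m [::] B = mu B.
Hypothesis m_rcons : forall s B, measurable B ->
  m s B = (m (rcons s false) B + m (rcons s true) B)%E.

Let m_le s B : measurable B -> (m s B <= mu B)%E.
Proof.
move=> mB; elim/last_ind: s => [|s b ih]; first by rewrite m_nil.
apply: le_trans ih; rewrite (m_rcons s mB).
by case: b; [apply: leeDr|apply: leeDl]; exact: measure_ge0.
Qed.

(** Each [m s] is dominated by [mu] and has a Radon-Nikodym density. There are countably many words
    [s], so for almost every [x] the values of all the densities at [x] are consistent and are the
    cylinder weights of a probability. *)
Lemma bimeasure_kernel : exists2 k : X -> probability cantor R,
  forall A, measurable A -> measurable_fun [set: X] (k ^~ A) &
  forall s B, measurable B -> m s B = (\int[mu]_(x in B) k x (cyl s))%E.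
Proof.
have fin s : (m s setT < +oo)%E.
  rewrite (le_lt_trans (m_le s measurableT))//.
  by rewrite (le_lt_trans (probability_le1 mu measurableT))// ltry.
pose fm s : {finite_measure set X -> \bar R} := mfrestr measurableT (fin s).
have fmE s A : fm s A = m s A by rewrite /fm/= /mfrestr /mrestr setIT.
have dom s : fm s `<< mu.
  apply/null_content_dominatesP => A mA muA0; rewrite fmE.
  by apply/eqP; rewrite -measure_le0 -muA0; exact: m_le.
have /choice[D DP] : forall s, exists D : X -> \bar R, [/\ forall x, (0 <= D x)%E,
    forall x, D x \is a fin_num, mu.-integrable [set: X] D &
    forall B, measurable B -> m s B = (\int[mu]_(x in B) D x)%E].
  move=> s; have [D [? ? ? DE]] := radon_nikodym_sigma_finite (nu := fm s) (dom s).
  by exists D; split => // B mB; rewrite -fmE DE.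
have D0 s x : (0 <= D s x)%E by have [] := DP s.
have Dfin s x : D s x \is a fin_num by have [] := DP s.
have Dint s : mu.-integrable [set: X] (D s) by have [] := DP s.
have DE s B : measurable B -> m s B = (\int[mu]_(x in B) D s x)%E.
  by have [_ _ _] := DP s; apply.
have mD s : measurable_fun [set: X] (D s) by exact: measurable_int (Dint s).
have ae_nil : ae_eq mu setT (D [::]) (cst 1%E).
  apply: integral_ae_eq => // E _ mE.
  by rewrite -DE// m_nil// integral_cst// mul1e.
have ae_rcons s : ae_eq mu setT (D s) (D (rcons s false) \+ D (rcons s true))%E.
  apply: integral_ae_eq => //; first exact: emeasurable_funD.
  move=> E _ mE; rewrite -DE// m_rcons// !DE// ge0_integralD//;
    exact: measurable_funTS.
(* Quantifying over codes [n] rather than words [s] puts the countably many null sets in the form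
   that [ae_foralln] merges. *)
have : \forall x \ae mu, forall n, D [::] x = 1%E /\
    (forall s : seq bool, unpickle n = Some s ->
      D s x = (D (rcons s false) x + D (rcons s true) x)%E).
  apply: ae_foralln => n; case nE : (unpickle n) => [s|].
    apply: filterS2 ae_nil (ae_rcons s) => x /(_ I) ? /(_ I) ?.
    by split=> // _ [<-].
  by apply: filterS ae_nil => x /(_ I).
move=> [N [mN N0 NP]].
have good x : x \notin N -> D [::] x = 1%E /\
    forall s, D s x = (D (rcons s false) x + D (rcons s true) x)%E.
  rewrite notin_setE => xN; have {}xN := contra_not (NP x) xN.
  move/contrapT in xN; split; first by have [] := xN 0.
  by move=> s; apply: (xN (pickle s)).2; rewrite pickleK.
(* On the null set [N] the weights are those of the point mass at the constantly [false] sequence,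
   which are consistent as well. *)
pose p x s : R := if x \in N then (all negb s)%:R else fine (D s x).
have p0 x s : 0 <= p x s.
  by rewrite /p; case: ifPn => _; [rewrite ler0n|rewrite fine_ge0].
have p1 x : p x [::] = 1.
  by rewrite /p; case: ifPn => // /good[-> _].
have pD x s : p x s = p x (rcons s false) + p x (rcons s true).
  rewrite /p; case: ifPn => [_|/good[_ ->]]; last by rewrite fineD.
  by rewrite !all_rcons/= addr0.
have /choice[k kP] : forall x, exists P : probability cantor R,
    forall s, P (cyl s) = (p x s)%:E.
  by move=> x; exact: subdivision_probability.
have mp s : measurable_fun [set: X] (fun x => (p x s)%:E).
  apply/measurable_EFinP; apply: measurable_fun_ifT => //.
    by apply: (measurable_fun_bool true); rewrite setTI preimage_mem_true.
  exact: measurableT_comp.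
exists k.
  (* [k] was chosen point by point; it is measurable because its values on cylinders are the
     measurable weights [p]. *)
  apply: (@measurable_kernel_generator _ _ _ cantor _ cylinders) => //.
    exact: setI_cylinders.
  move=> _ [->|[s ->]].
    by under eq_fun do rewrite measure0; exact: measurable_cst.
  by under eq_fun do rewrite kP; exact: mp.
move=> s B mB; rewrite DE//.
apply: ge0_ae_eq_integral => //.
- exact: measurable_funTS.
- by under eq_fun do rewrite kP; exact: measurable_funTS.
exists N; split => // x /= /not_implyP[_]; apply: contra_notP => xN.
by rewrite kP /p ifN ?fineK// notin_setE.
Qed.

End bimeasure.

(** * Spaces that embed in the Cantor space *)

(* A measurable retract of the Cantor space: a substitute for being standard Borel
   that asks nothing of the range of [b]. *)
Definition standard {d} (T : measurableType d) :=
  exists (b : T -> cantor) (r : cantor -> T),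
    [/\ measurable_fun [set: T] b, measurable_fun [set: cantor] r & cancel b r].

Lemma standard_prod {d d'} (T : measurableType d) (S : measurableType d') :
  standard T -> standard S -> standard (T * S)%type.
Proof.
move=> [b [r [mb mr bK]]] [b' [r' [mb' mr' bK']]].
pose c (x : T * S) : cantor :=
  fun n => if odd n then b' x.2 n./2 else b x.1 n./2.
exists c, (fun y => (r (fun n => y n.*2), r' (fun n => y n.*2.+1))); split.
- apply: measurable_cantor => n; rewrite /c; case: odd.
    exact: measurableT_comp (measurable_fun_coordinate n./2)
      (measurableT_comp mb' measurable_snd).
  exact: measurableT_comp (measurable_fun_coordinate n./2)
    (measurableT_comp mb measurable_fst).
- apply: measurable_fun_pair.
    apply: measurableT_comp mr _; apply: measurable_cantor => n.
    exact: measurable_fun_coordinate.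
  apply: measurableT_comp mr' _; apply: measurable_cantor => n.
  exact: measurable_fun_coordinate.
move=> [x y]; rewrite /c/=; congr pair.
  rewrite -[RHS]bK; congr r; apply/funext => n.
  by rewrite odd_double doubleK.
rewrite -[RHS]bK'; congr r'; apply/funext => n.
by rewrite odd_double/= uphalf_double.
Qed.

(* Transporting to the Cantor space along [b], where cylinders are stable under
   intersection, and back along its left inverse [r]. *)
Lemma bimeasure_disintegration {dX dW} {X : measurableType dX}
    {W : measurableType dW} {R : realType} (mu : probability X R)
    (wX : set W -> {measure set X -> \bar R})
    (wW : set X -> {measure set W -> \bar R}) :
  standard W ->
  (forall A B, measurable A -> measurable B -> wX A B = wW B A) ->
  (forall B, measurable B -> wX setT B = mu B) ->
  exists2 k : X -> probability W R,
    forall A, measurable A -> measurable_fun [set: X] (k ^~ A) &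
    forall A B, measurable A -> measurable B ->
      wX A B = (\int[mu]_(x in B) k x A)%E.
Proof.
move=> [b [r [mb mr bK]]] wXW wT.
have mpre A : measurable A -> measurable (b @^-1` A).
  by move=> mA; rewrite -[X in measurable X]setTI; exact: mb.
have mC s : measurable (b @^-1` cyl s) by apply: mpre; exact: measurable_cyl.
pose m s := wX (b @^-1` cyl s).
have [||k mk kP] := @bimeasure_kernel _ _ _ mu m.
- by move=> B mB; rewrite /m cyl_nil preimage_setT wT.
- move=> s B mB; rewrite /m !wXW// -measureU//.
  + by rewrite -preimage_setU -cyl_split.
  + by rewrite -preimage_setI cyl_disjoint preimage_set0.
exists (fun x => law (k x) mr).
  move=> B mB; apply: mk; rewrite -[X in measurable X]setTI; exact: mr.
move=> A B mA mB.
(* The kernel came from densities in the variable [B]. With [B] fixed, additivity in [A], available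
   through [wW], carries the identity from cylinders to all measurable sets. *)
pose m1 := mpush (wW B) mb.
have m1E C : m1 C = wW B (b @^-1` C) by [].
have [m2 m2E] := mixture_measure mu mB mk.
have m1T : m1 setT = mu B by rewrite m1E preimage_setT -wXW// wT.
have -> : wX A B = m1 (r @^-1` A).
  rewrite m1E wXW//; congr (wW B _).
  by apply/seteqP; split=> x; rewrite /= bK.
rewrite (@eq_finite_measure _ cantor _ cylinders m1 m2) //.
- exact: setI_cylinders.
- by rewrite m1T (le_lt_trans (probability_le1 _ _)) ?ltry.
- rewrite m1T m2E.
  under eq_integral do rewrite probability_setT.
  by rewrite integral_cst// mul1e.
- move=> _ [->|[s ->]]; first by rewrite !measure0.
  by rewrite m1E -wXW// -[LHS]/(m s B) kP// m2E.
- by rewrite -[X in measurable X]setTI; exact: mr.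
Qed.

(** The probability that [X] is in [B] and [Z] in [A] is a measure in each of the two sets, hence a
    bimeasure to disintegrate. The zero measure fills in for non-measurable arguments. *)
Lemma exists_cond_law {dT dS dW} {T : measurableType dT}
    {S : measurableType dS} {W : measurableType dW} {R : realType}
    (P : probability T R) (X : T -> S) (Z : T -> W) :
  measurable_fun [set: T] X -> measurable_fun [set: T] Z -> standard W ->
  exists k, is_cond_law P X Z k.
Proof.
move=> mX mZ stW.
have mXI A : measurable A -> measurable (X @^-1` A).
  by move=> mA; rewrite -[X in measurable X]setTI; exact: mX.
have mZI A : measurable A -> measurable (Z @^-1` A).
  by move=> mA; rewrite -[X in measurable X]setTI; exact: mZ.
have /choice[wX wXE] : forall A, exists m : {measure set S -> \bar R},
    measurable A -> forall B, m B = P (X @^-1` B `&` Z @^-1` A).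
  move=> A; have [mA|?] := pselect (measurable A); last by exists mzero.
  by exists (mpush (mrestr P (mZI _ mA)) mX).
have /choice[wW wWE] : forall B, exists m : {measure set W -> \bar R},
    measurable B -> forall A, m A = P (X @^-1` B `&` Z @^-1` A).
  move=> B; have [mB|?] := pselect (measurable B); last by exists mzero.
  by exists (mpush (mrestr P (mXI _ mB)) mZ) => _ A; rewrite setIC.
have [||k mk kP] := @bimeasure_disintegration _ _ _ _ _ (law P mX) wX wW stW.
- by move=> A B mA mB; rewrite wXE// wWE.
- by move=> B mB; rewrite wXE// preimage_setT setIT.
by exists k; split=> // A B mA mB; rewrite -wXE// kP.
Qed.

(** [seqDU E n] consists of the points whose first index is [n], so preimages under [f] are unions
    of such sets. Off the union of the [E n] the value is the default 0, whence the extra term when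
    0 belongs to [B]. *)
Lemma measurable_first {d} {T : measurableType d} (E : (set T)^nat) :
  (forall n, measurable (E n)) ->
  exists2 f : T -> nat, measurable_fun [set: T] f &
    forall t, (exists n, E n t) ->
      E (f t) t /\ forall n, (n < f t)%N -> ~ E n t.
Proof.
move=> mE; pose f t := xget 0%N [set n | seqDU E n t].
have fP t n : seqDU E n t -> f t = n.
  move=> h; apply: xget_unique => //= m hm; apply/eqP/negPn/negP => mn.
  have /trivIsetP/(_ m n I I mn) := trivIset_seqDU E.
  by rewrite -[False]/(set0 t) => <-; split.
have fE t : (exists n, E n t) -> seqDU E (f t) t.
  move=> [n Ent]; have : (\bigcup_k seqDU E k) t by rewrite -seqDU_bigcup_eq; exists n.
  by move=> [k _ kt]; rewrite (fP _ _ kt).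
have mS n : measurable (seqDU E n).
  by apply: measurableD => //; exact: bigsetU_measurable.
exists f.
  move=> _ B _; rewrite setTI.
  rewrite (_ : f @^-1` B = \bigcup_(n in B) seqDU E n `|`
      (if 0%N \in B then ~` \bigcup_n E n else set0)).
    apply: measurableU; first exact: bigcup_measurable.
    by case: ifPn => // _; apply: measurableC; exact: bigcup_measurable.
  apply/seteqP; split=> t /=.
    move=> Bf; have [h|h] := pselect (exists n, E n t).
      by left; exists (f t) => //; exact: fE.
    right; have f0 : f t = 0%N.
      rewrite /f; case: xgetP => // k _ /= kt.
      by exfalso; apply: h; exists k; exact: subset_seqDU kt.
    by rewrite -f0 mem_set//= => -[n _ nt]; apply: h; exists n.
  move=> [[n Bn] /fP -> //|]; case: ifPn => // B0 h.
  rewrite /f; case: xgetP; last by move=> _; rewrite inE in B0.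
  by move=> k _ /= kt; exfalso; apply: h; exists k => //; exact: subset_seqDU kt.
move=> t /fE h; split; first exact: subset_seqDU h.
move=> n nf Ent; have [_] := h; apply; rewrite -bigcup_mkord.
by exists n.
Qed.

(** * Separable Banach spaces as measurable retracts of the Cantor space *)

Section standard_borel.
Context {R : realType} {V : completeNormedModType R}.
Hypothesis sepV : separable V.

Let h k : R := 2^-1 ^+ k.

Let h0 k : 0 < h k. Proof. by rewrite exprn_gt0// invr_gt0. Qed.

Let hS k : h k = 2 * h k.+1.
Proof. by rewrite /h exprS mulrA divff// mul1r. Qed.

Let hcvg e : 0 < e -> exists k, h k < e.
Proof.
move=> e0; have /cvgrPdist_lt/(_ _ e0) : h @ \oo --> (0 : R).
  by apply: cvg_expr; rewrite ger0_norm ?invr_ge0// invf_lt1// ltr1n.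
by move=> [k _ /(_ k (leqnn k))]; rewrite sub0r normrN gtr0_norm//; exists k.
Qed.

Let dense_seq : exists e : nat -> V, forall v r, 0 < r ->
  exists n, `|v - e n| < r.
Proof.
have [D cD dD] := sepV.
have hD v r : 0 < r -> exists2 d, D d & `|v - d| < r.
  move=> r0; have [||d [/= vd Dd]] := dD (ball v r); last by
    exists d => //; rewrite -ball_normE in vd.
  - by exists v; exact: ballxx.
  - exact: ball_open.
case/pfcard_geP : (cD) => [D0|[f]].
  by have [d] := hD 0 1 ltr01; rewrite D0 => -[].
exists f => v r r0; have [d Dd vd] := hD v r r0.
have fs : set_surj [set: nat] D f by exact: surj.
by have [n _ nd] := fs _ Dd; exists n; rewrite nd.
Qed.

(** [b v] records, for all [k] and [n], whether [v] is within 2^-k of the dense point [e n]. [r]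
    reads from a sequence one recorded point per precision and takes their limit, which exists by
    completeness on [G]; elsewhere [r] is 0. *)
Lemma standard_borel : standard (borel V).
Proof.
have [e eP] := dense_seq.
pose b (v : borel V) : cantor := fun m =>
  if unpickle m is Some kn then `|(v : V) - e kn.2| < h kn.1 else false.
have bE v (k n : nat) : b v (pickle (k, n)) = (`|(v : V) - e n| < h k).
  by rewrite /b pickleK.
pose E (k n : nat) : set cantor := [set x : cantor | x (pickle (k, n))].
have mE k n : measurable (E k n).
  have := @measurable_fun_coordinate (pickle (k, n)) measurableT [set true] I.
  by rewrite setTI.
have /choice[N NP] : forall k, exists f : cantor -> nat,
    measurable_fun [set: cantor] f /\
    forall x, (exists n, E k n x) -> E k (f x) x.
  move=> k; have [f mf fP] := measurable_first (mE k).
  by exists f; split => // x /fP[].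
have mN k (B : set nat) : measurable [set x : cantor | B (N k x)].
  by have := (NP k).1 measurableT B I; rewrite setTI.
pose z k x := e (N k x).
(* Centers within [h k] and [h k.+1] of a common point are closer than [2 * h k], so [G] contains
   the range of [b]; and these bounds are summable, so the centers are Cauchy on [G]. *)
pose G := \bigcap_k [set x : cantor | `|z k x - z k.+1 x| < 2 * h k].
have mG : measurable G.
  apply: bigcapT_measurable => k.
  rewrite (_ : [set x | _] = \bigcup_n ([set x : cantor | N k x = n] `&`
      [set x | [set i | `|e n - e i| < 2 * h k] (N k.+1 x)])).
    apply: bigcupT_measurable => n; apply: measurableI; last exact: mN.
    exact: (mN k [set n]).
  apply/seteqP; split=> x /=; first by move=> ?; exists (N k x).
  by move=> [n _ [/= <-]].
(* The right side is the telescoped sum of the bounds [2 * h j] for [j] from [k] to [k + i - 1]. *)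
have zG x : G x -> forall k i, `|z k x - z (k + i)%N x| <= 4 * h k - 4 * h (k + i)%N.
  move=> Gx k; elim=> [|i ih]; first by rewrite addn0 subrr normr0 subrr.
  rewrite addnS (le_trans (ler_distD (z (k + i)%N x) _ _))//.
  rewrite (le_trans (lerD ih (ltW (Gx (k + i)%N I))))//.
  by rewrite (hS (k + i)%N); lra.
have zG4 x : G x -> forall k m, (k <= m)%N -> `|z k x - z m x| <= 4 * h k.
  move=> Gx k m km; rewrite -(subnKC km) (le_trans (zG x Gx _ _))//.
  by rewrite gerBl// mulr_ge0// ltW.
pose r (x : cantor) : borel V :=
  if x \in G then lim ((z ^~ x) @ \oo) else 0.
have zcvg x : G x -> (z ^~ x) k @[k --> \oo] --> (r x : V).
  move=> Gx; rewrite /r mem_set//; apply: cauchy_cvg; apply/cauchy_exP => eps eps0.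
  have [k hk] : exists k, h k < eps / 4 by apply: hcvg; rewrite divr_gt0.
  exists (z k x); exists k => // m /= km; rewrite -ball_normE/=.
  by rewrite (le_lt_trans (zG4 x Gx _ _ km))// mulrC -ltr_pdivlMr.
have rz x : G x -> forall k, `|z k x - (r x : V)| <= 4 * h k.
  move=> Gx k.
  have : `|z k x - z m x| @[m --> \oo] --> `|z k x - (r x : V)|.
    by apply: cvg_norm; apply: cvgB; [exact: cvg_cst|exact: zcvg].
  move/cvg_lim => <- //; apply: limr_le.
    by apply/cvg_ex; eexists; apply: cvg_norm; apply: cvgB;
      [exact: cvg_cst|exact: zcvg].
  by exists k => // m /= km; exact: zG4.
have bN v k : `|v - z k (b v)| < h k.
  rewrite -bE; apply: (NP k).2.
  by have [n vn] := eP v (h k) (h0 k); exists n; rewrite /E/= bE.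
have Gb v : G (b v).
  move=> k _ /=; rewrite (le_lt_trans (ler_distD v _ _))// mulr_natl mulr2n.
  apply: ltrD; first by rewrite distrC.
  by rewrite (lt_trans (bN v _))// (hS k) ltr_pMl// ltr1n.
exists b, r; split.
- apply: measurable_cantor => m; rewrite /b; case: unpickle => [[k n]|/=].
    apply: (measurable_fun_bool true); rewrite setTI.
    apply: sub_sigma_algebra.
    rewrite (_ : _ @^-1` _ = ball (e n) (h k)); first exact: ball_open.
    by apply/seteqP; split=> v /=; rewrite -ball_normE/= distrC.
  exact: measurable_cst.
- apply: (@measurability _ _ _ (borel V) _ _ open) => // _ [Q oO <-].
  (* [r x] is within [4 * h k] of [z k x], so it lies in the ball of radius [5 * h k]; conversely
     that ball stays within [9 * h k] of [r x], which is the origin of the 9 below. *)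
  rewrite setTI (_ : r @^-1` Q =
     (G `&` \bigcup_k [set x | [set n | ball (e n) (5 * h k) `<=` Q] (N k x)])
     `|` (if (0 : V) \in Q then ~` G else set0)).
    apply: measurableU; last by case: ifPn => // _; exact: measurableC.
    by apply: measurableI => //; apply: bigcupT_measurable => k; exact: mN.
  apply/seteqP; split=> x /=.
    have [Gx Ox|nG] := pselect (G x); last first.
      by rewrite /r memNset// => O0; right; rewrite mem_set.
    left; split => //.
    have /nbhs_ballP[eps /= eps0 epsO] := open_nbhs_nbhs (conj oO Ox).
    have [k hk] : exists k, h k < eps / 9 by apply: hcvg; rewrite divr_gt0.
    exists k => // w /=; rewrite -ball_normE/= => zw; apply: epsO.
    rewrite -ball_normE/=; rewrite ltr_pdivlMr// in hk.
    rewrite (le_lt_trans (ler_distD (z k x) _ _))//.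
    have := rz x Gx k; rewrite distrC => rzx.
    rewrite (lt_trans _ hk)//.
    rewrite (lt_le_trans (ler_ltD rzx zw))//.
    by lra.
  move=> [[Gx [k _ /= kO]]|].
    apply: kO; rewrite -ball_normE/= (le_lt_trans (rz x Gx k))//.
    by rewrite ltr_pM2r// ltr_nat.
  by case: ifPn => // O0 nG; rewrite /r memNset//; rewrite inE in O0.
- move=> v; apply: (@cvg_unique _ _ (z k (b v) @[k --> \oo])) => //.
    exact: zcvg.
  apply/cvgrPdist_lt => eps /hcvg[k hk]; exists k => // m /= km.
  rewrite (lt_trans (bN v m))// (le_lt_trans _ hk)//.
  by rewrite ler_wiXn2l// ?invr_ge0// invf_le1// ler1n.
Qed.

End standard_borel.

(** * Ultrafilter limits of couplings *)

Lemma cvg_bigsum {R : realType} {I J : Type} (s : seq I) (F : set_system J)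
    (FF : Filter F) (f : I -> J -> R) (l : I -> R) :
  (forall i, f i k @[k --> F] --> l i) ->
  \sum_(i <- s) f i k @[k --> F] --> \sum_(i <- s) l i.
Proof.
move=> fl; elim: s => [|i s ih].
  by under eq_fun do rewrite big_nil; rewrite big_nil; exact: cvg_cst.
under eq_fun do rewrite big_cons.
by rewrite big_cons; exact: cvgD.
Qed.

Section ultralimit.
Context {R : realType} (U : set_system nat).
Hypothesis UU : UltraFilter U.

(** The image of an ultrafilter is an ultrafilter, and a segment is compact. All bounded sequences
    thus converge along the same [U], with no subsequence to extract. *)
Lemma ultra_cvg (x : nat -> R) M :
  (forall k, 0 <= x k <= M) -> exists l : R, x k @[k --> U] --> l.
Proof.
move=> xM; have cM : compact `[0, M]%classic by exact: segment_compact.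
rewrite compact_ultra in cM.
have UxU : UltraFilter (x @ U).
  split; first exact: fmap_proper_filter.
  move=> G GF xUG; apply/seteqP; split => // A GA.
  have [//|UnA] := in_ultra_setVsetC (x @^-1` A) UU.
  have GnA : G (~` A) by exact: xUG.
  by have /filter_ex[? []] : G (A `&` ~` A) by exact: filterI.
have [|l [_ xl]] := cM (x @ U) UxU; last by exists l.
by apply: (@filterE _ U) => k; rewrite /= in_itv/=; exact: xM.
Qed.

(** Limits preserve finite additivity. The common bound [mu] gives countable additivity: the limit
    mass of the tail of a disjoint union is at most its [mu]-mass, which tends to 0. *)
Lemma ultralimit_measure d (T : measurableType d) (mu : probability T R)
    (m : nat -> {measure set T -> \bar R}) :
  (forall k A, measurable A -> (m k A <= mu A)%E) ->
  exists w : {measure set T -> \bar R}, forall A, measurable A ->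
    (w A <= mu A)%E /\ fine (m k A) @[k --> U] --> fine (w A).
Proof.
move=> mmu.
have fmu A : measurable A -> mu A \is a fin_num.
  by move=> mA; exact: fin_num_measure.
have fm k A : measurable A -> m k A \is a fin_num.
  move=> mA; rewrite ge0_fin_numE// (le_lt_trans (mmu _ _ mA))//.
  by rewrite (le_lt_trans (probability_le1 _ mA))// ltry.
have mfmu k A : measurable A -> 0 <= fine (m k A) <= fine (mu A).
  by move=> mA; rewrite fine_ge0//= fine_le// ?fm ?fmu// mmu.
(* Off measurable sets the value is a default 0; nonnegativity is recorded there too, since a
   measure has to be nonnegative on every set. *)
have /choice[w wP] : forall A, exists l : R, 0 <= l /\ (measurable A ->
    l <= fine (mu A) /\ fine (m k A) @[k --> U] --> l).
  move=> A; have [mA|mA] := pselect (measurable A); last by exists 0.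
  have [l hl] := ultra_cvg (fun k => mfmu k A mA).
  exists l; split.
    rewrite -(cvg_lim _ hl)//; apply: limr_ge; first by apply/cvg_ex; exists l.
    by apply: nearW => k; case/andP: (mfmu k A mA).
  move=> _; split => //.
  rewrite -(cvg_lim _ hl)//; apply: limr_le; first by apply/cvg_ex; exists l.
  by apply: nearW => k; case/andP: (mfmu k A mA).
have wcvg A : measurable A -> fine (m k A) @[k --> U] --> w A.
  by move=> mA; case: ((wP A).2 mA).
have wuniq A l : measurable A -> fine (m k A) @[k --> U] --> l -> w A = l.
  by move=> mA; apply: cvg_unique => //; exact: wcvg.
pose W A := (w A)%:E.
have W0 : W set0 = 0%E.
  rewrite /W (wuniq _ 0)//; apply: cvg_near_cst; apply: nearW => k.
  by rewrite measure0.
have Wge0 A : (0 <= W A)%E by rewrite lee_fin; exact: (wP A).1.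
have Ws : semi_sigma_additive W.
  move=> F mF tF mUF.
  pose S n := \big[setU/set0]_(i < n) F i.
  have mS n : measurable (S n) by exact: bigsetU_measurable.
  have mrest n : measurable (\bigcup_i F i `\` S n) by exact: measurableD.
  have sumF (nu : {measure set T -> \bar R}) n :
      (forall A, measurable A -> nu A \is a fin_num) ->
      fine (nu (\bigcup_i F i)) =
      \sum_(0 <= i < n) fine (nu (F i)) + fine (nu (\bigcup_i F i `\` S n)).
    move=> fnu.
    have SU : S n `<=` \bigcup_i F i.
      by rewrite /S -bigcup_mkord; apply: bigcup_sub => i _ x Fx; exists i.
    rewrite -[in LHS](setDUK SU) measureU//; last first.
      by rewrite setDE setICA setICr setI0.
    rewrite fineD ?fnu//; congr (_ + _).
    rewrite measure_semi_additive_ord_I//; last 2 first.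
      exact: sub_trivIset tF.
      exact: mS.
    by rewrite -sum_fine ?big_mkord// => i _; exact: fnu.
  have wrest n : w (\bigcup_i F i) =
      \sum_(0 <= i < n) w (F i) + w (\bigcup_i F i `\` S n).
    apply: wuniq => //; under eq_fun do rewrite (sumF _ n (fm _)).
    apply: cvgD; last exact: wcvg.
    by apply: cvg_bigsum => i; exact: wcvg.
  rewrite (_ : (fun n => _) =
      EFin \o (fun n => w (\bigcup_i F i) - w (\bigcup_i F i `\` S n))); last first.
    by apply/funext => n /=; rewrite {1}(wrest n) addrK /W sumEFin.
  apply: cvg_EFin; first exact: nearW.
  rewrite -[X in _ --> X]subr0; apply: cvgB; first exact: cvg_cst.
  have restE n : fine (mu (\bigcup_i F i `\` S n)) =
      fine (mu (\bigcup_i F i)) - fine (\sum_(0 <= i < n) mu (F i))%E.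
    rewrite (sumF _ n fmu) -sum_fine; first by rewrite addrC addKr.
    by move=> i _; exact: fmu.
  apply: (@squeeze_cvgr _ _ _ _ (cst 0) (fun n => fine (mu (\bigcup_i F i `\` S n)))).
  - by apply: nearW => n; rewrite (wP _).1/=; case: ((wP _).2 (mrest n)).
  - exact: cvg_cst.
  - under eq_fun do rewrite restE.
    have <- : fine (mu (\bigcup_i F i)) - fine (mu (\bigcup_i F i)) = 0.
      exact: subrr.
    apply: cvgB; first exact: cvg_cst.
    apply: fine_cvg; rewrite fineK ?fmu//.
    exact: measure_semi_sigma_additive.
pose M : {measure set T -> \bar R} :=
  HB.pack W (isMeasure.Build _ _ _ W W0 Wge0 Ws).
exists M => A mA; have [wmu wc] := (wP A).2 mA; split => //.
by rewrite -[M A]/(w A)%:E -(fineK (fmu A mA)) lee_fin.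
Qed.

(** [mu] dominates the masses of rectangles in the first variable and [alpha] in the second, so
    their limits form a bimeasure. Convergence is claimed on rectangles only. *)
Lemma ultralimit_coupling {dX dV} {X : measurableType dX}
    {V : measurableType dV} (mu : probability X R) (alpha : probability V R)
    (p : nat -> probability (X * V)%type R) :
  standard V ->
  (forall k B, measurable B -> p k (B `*` setT) = mu B) ->
  (forall k A, measurable A -> p k (setT `*` A) = alpha A) ->
  exists q : probability (X * V)%type R, forall B A,
    measurable B -> measurable A ->
    fine (p k (B `*` A)) @[k --> U] --> fine (q (B `*` A)).
Proof.
move=> stV pmu palpha.
have mf A : measurable A -> measurable ((snd : X * V -> V) @^-1` A).
  by move=> mA; rewrite -[X in measurable X]setTI; exact: measurable_snd.
have mg B : measurable B -> measurable ((fst : X * V -> X) @^-1` B).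
  by move=> mB; rewrite -[X in measurable X]setTI; exact: measurable_fst.
have /choice[wX wXP] : forall A, exists w : {measure set X -> \bar R},
    measurable A -> forall B, measurable B ->
      (w B <= mu B)%E /\ fine (p k (B `*` A)) @[k --> U] --> fine (w B).
  move=> A; have [mA|?] := pselect (measurable A); last by exists mzero.
  pose m k := mpush (mrestr (p k) (mf _ mA)) measurable_fst.
  have [k B mB|w wP] := @ultralimit_measure _ _ mu m.
    rewrite -(pmu k)// -[leLHS]/(p k _); apply: le_measure; rewrite ?inE.
    - by apply: measurableI; [exact: (mg _ mB)|exact: (mf _ mA)].
    - exact: measurableX.
    - by move=> x [].
  by exists w => _ B mB; exact: wP.
have /choice[wV wVP] : forall B, exists w : {measure set V -> \bar R},
    measurable B -> forall A, measurable A ->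
      (w A <= alpha A)%E /\ fine (p k (B `*` A)) @[k --> U] --> fine (w A).
  move=> B; have [mB|?] := pselect (measurable B); last by exists mzero.
  pose m k := mpush (mrestr (p k) (mg _ mB)) measurable_snd.
  have mE k A : m k A = p k (B `*` A) by rewrite -[LHS]/(p k (_ `&` _)) setIC.
  have [k A mA|w wP] := @ultralimit_measure _ _ alpha m.
    rewrite -(palpha k)// mE; apply: le_measure; rewrite ?inE.
    - exact: measurableX.
    - exact: measurableX.
    - by move=> x [].
  exists w => _ A mA; have [h1 h2] := wP A mA; split=> //.
  by under eq_fun do rewrite -mE.
have wXfin A B : measurable A -> measurable B -> wX A B \is a fin_num.
  move=> mA mB; rewrite ge0_fin_numE// (le_lt_trans (wXP A mA B mB).1)//.
  by rewrite (le_lt_trans (probability_le1 _ mB))// ltry.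
have wVfin A B : measurable A -> measurable B -> wV B A \is a fin_num.
  move=> mA mB; rewrite ge0_fin_numE// (le_lt_trans (wVP B mB A mA).1)//.
  by rewrite (le_lt_trans (probability_le1 _ mA))// ltry.
have [||k mk kP] := @bimeasure_disintegration _ _ _ _ _ mu wX wV stV.
- move=> A B mA mB.
  rewrite -(fineK (wXfin A B mA mB)) -(fineK (wVfin A B mA mB)); congr _%:E.
  by apply: (@cvg_unique _ _ (fine (p k (B `*` A)) @[k --> U])) => //;
    [exact: (wXP A mA B mB).2|exact: (wVP B mB A mA).2].
- move=> B mB.
  have mufin : mu B \is a fin_num by exact: fin_num_measure.
  rewrite -(fineK (wXfin setT B measurableT mB)) -(fineK mufin); congr _%:E.
  apply: (@cvg_unique _ _ (fine (p k (B `*` setT)) @[k --> U])) => //.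
    exact: (wXP setT measurableT B mB).2.
  rewrite (_ : (fun k => _) = cst (fine (mu B))); first exact: cvg_cst.
  by apply/funext => k; rewrite pmu.
have [q [qmu [_ qk]]] := joint_probability mu mk.
exists q => B A mB mA.
have -> : q (B `*` A) = wX A B.
  rewrite kP// -[LHS]/(q (_ `&` _)) qk//.
  by apply: eq_measure_integral => C mC _; exact: qmu.
exact: (wXP A mA B mB).2.
Qed.

End ultralimit.

(** * Near-optimal finite plans *)

Section completion.
Context {R : realType} {I J : finType} (a : I -> R) (b : J -> R).
Hypothesis a0 : forall i, 0 <= a i.
Hypothesis b0 : forall j, 0 <= b j.
Hypothesis a1 : \sum_i a i = 1.
Hypothesis b1 : \sum_j b j = 1.

(* Plans are densities [q] with respect to the product of the weights [a] and [b]. *)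
Definition row_mass (q : I -> J -> R) i := \sum_j q i j * b j.
Definition col_mass (q : I -> J -> R) j := \sum_i q i j * a i.
Definition defect (q : I -> J -> R) := 1 - \sum_i \sum_j q i j * b j * a i.

(** The defect must be strictly positive because [completion] divides by it. The test is boolean and
    bears on finitely many numbers, so it is measurable when the weights are. *)
Definition subcoupling (q : I -> J -> R) :=
  [forall i, row_mass q i <= 1] && [forall j, col_mass q j <= 1] &&
  (0 < defect q).

(* The missing row and column masses are spread as a product, which turns a
   subcoupling into a coupling. *)
Definition completion (q : I -> J -> R) i j :=
  q i j + (1 - row_mass q i) * (1 - col_mass q j) / defect q.

Definition cost (F h : I -> J -> R) := \sum_i \sum_j F i j * (h i j * b j * a i).

(** Missing row masses and missing column masses have the same total, the defect. This is why their
    product divided by the defect has exactly the missing masses as marginals. *)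
Lemma sum_row_defect q : \sum_i (1 - row_mass q i) * a i = defect q.
Proof.
under eq_bigr do rewrite mulrBl mul1r.
rewrite sumrB a1 /defect; congr (_ - _); apply: eq_bigr => i _.
by rewrite mulr_suml.
Qed.

Lemma sum_col_defect q : \sum_j (1 - col_mass q j) * b j = defect q.
Proof.
under eq_bigr do rewrite mulrBl mul1r.
rewrite sumrB b1 /defect exchange_big; congr (_ - _); apply: eq_bigr => j _ /=.
by rewrite mulr_suml; apply: eq_bigr => i _; rewrite mulrAC.
Qed.

Section completion_of_subcoupling.
Variable q : I -> J -> R.
Hypothesis q0 : forall i j, 0 <= q i j.
Hypothesis qs : subcoupling q.

Let rq i : row_mass q i <= 1.
Proof. by case/andP : qs => /andP[/forallP/(_ i)]. Qed.
Let cq j : col_mass q j <= 1.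
Proof. by case/andP : qs => /andP[_ /forallP/(_ j)]. Qed.
Let d0 : 0 < defect q.
Proof. by case/andP : qs. Qed.

Lemma completion_ge0 i j : 0 <= completion q i j.
Proof. by rewrite addr_ge0// divr_ge0 ?(ltW d0)// mulr_ge0// subr_ge0. Qed.

Lemma completion_row i : \sum_j completion q i j * b j = 1.
Proof.
rewrite (eq_bigr (fun j => q i j * b j +
    (1 - row_mass q i) / defect q * ((1 - col_mass q j) * b j))); last first.
  by move=> j _; rewrite /completion; ring.
rewrite big_split/= -mulr_sumr sum_col_defect divfK ?gt_eqF//.
by rewrite -/(row_mass q i) addrC subrK.
Qed.

Lemma completion_col j : \sum_i completion q i j * a i = 1.
Proof.
rewrite (eq_bigr (fun i => q i j * a i +
    (1 - col_mass q j) / defect q * ((1 - row_mass q i) * a i))); last first.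
  by move=> i _; rewrite /completion; ring.
rewrite big_split/= -mulr_sumr sum_row_defect divfK ?gt_eqF//.
by rewrite -/(col_mass q j) addrC subrK.
Qed.

(** The added mass totals [defect q], and each unit of it costs at most [M]. *)
Lemma cost_completion F M : (forall i j, F i j <= M) ->
  cost F (completion q) <= cost F q + M * defect q.
Proof.
move=> FM.
have -> : M * defect q = \sum_i \sum_j
    M * ((1 - row_mass q i) * a i * ((1 - col_mass q j) * b j) / defect q).
  under eq_bigr do rewrite -mulr_sumr -mulr_suml -mulr_sumr sum_col_defect mulfK ?gt_eqF//.
  by rewrite -mulr_sumr sum_row_defect.
rewrite /cost -big_split/=; apply: ler_sum => i _.
rewrite -big_split/=; apply: ler_sum => j _.
rewrite (_ : F i j * (completion q i j * b j * a i) = F i j * (q i j * b j * a i) +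
  F i j * ((1 - row_mass q i) * a i * ((1 - col_mass q j) * b j) / defect q)).
  rewrite lerD2l ler_wpM2r// divr_ge0 ?(ltW d0)//.
  by rewrite !mulr_ge0// subr_ge0.
by rewrite /completion; ring.
Qed.

End completion_of_subcoupling.

(** The density of [w] is scaled by [1 - th] and rounded down to a multiple of the grid step [th].
    Scaling leaves a defect of at least [th], hence positive; scaling and rounding together leave at
    most [2 * th]. *)
Lemma grid_approximation (F w : I -> J -> R) e :
  (forall i j, 0 <= F i j) -> (forall i j, 0 <= w i j) ->
  (forall i, \sum_j w i j = a i) -> (forall j, \sum_i w i j = b j) -> 0 < e ->
  exists (N : nat) (n : I -> J -> nat),
    let q i j := (n i j)%:R / N.+1%:R in
    subcoupling q /\ cost F (completion q) <= \sum_i \sum_j F i j * w i j + e.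
Proof.
move=> F0 w0 wa wb e0.
pose M := \sum_i \sum_j F i j.
have FM i j : F i j <= M.
  rewrite /M (bigD1 i)//= (bigD1 j)//= -addrA lerDl addr_ge0// sumr_ge0// => *.
  exact: sumr_ge0.
have M0 : 0 <= M by rewrite /M !sumr_ge0// => *; rewrite sumr_ge0.
(* Chosen so that completing a defect of [2 * th] costs at most [2 * M * th], which is below [e]. *)
pose N := Num.truncn (2 * M / e).
have NM : 2 * M / e < N.+1%:R by rewrite truncnS_gt.
pose th : R := N.+1%:R^-1.
have th0 : 0 < th by rewrite invr_gt0.
have th1 : th <= 1 by rewrite invf_le1// ler1n.
(* Where a weight vanishes the quotient is 0 by convention; [w], bounded by its marginals, vanishes
   there too, so [hs] is its density in all cases. *)
pose hs i j := w i j / (a i * b j).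
have hs0 i j : 0 <= hs i j by rewrite divr_ge0// mulr_ge0.
have wle i j : w i j <= a i.
  by rewrite -wa (bigD1 j)//= lerDl sumr_ge0.
have wle' i j : w i j <= b j.
  by rewrite -wb (bigD1 i)//= lerDl sumr_ge0.
have hsw i j : hs i j * b j * a i = w i j.
  rewrite /hs; have [ai0|ai0] := eqVneq (a i) 0.
    by rewrite ai0 mulr0; apply/eqP; rewrite eq_le w0 -ai0 wle.
  have [bj0|bj0] := eqVneq (b j) 0.
    by rewrite bj0 mulr0 mul0r; apply/esym/eqP; rewrite eq_le w0 -bj0 wle'.
  by field; rewrite ai0 bj0.
have hsr i : \sum_j hs i j * b j <= 1.
  have [ai0|ai0] := eqVneq (a i) 0.
    by rewrite big1 ?ler01// => j _; rewrite /hs ai0 mul0r invr0 mulr0 mul0r.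
  rewrite -(ler_pM2r (x := a i)) ?lt_neqAle ?a0 1?eq_sym ?ai0// mul1r mulr_suml.
  by under eq_bigr do rewrite hsw; rewrite wa.
have hsc j : \sum_i hs i j * a i <= 1.
  have [bj0|bj0] := eqVneq (b j) 0.
    by rewrite big1 ?ler01// => i _; rewrite /hs bj0 mulr0 invr0 mulr0 mul0r.
  rewrite -(ler_pM2r (x := b j)) ?lt_neqAle ?b0 1?eq_sym ?bj0// mul1r mulr_suml.
  by under eq_bigr do rewrite mulrAC hsw; rewrite wb.
pose n i j := Num.truncn ((1 - th) * hs i j * N.+1%:R).
pose q i j : R := (n i j)%:R / N.+1%:R.
have th' : 0 <= 1 - th by rewrite subr_ge0.
have q0 i j : 0 <= q i j by rewrite divr_ge0.
have qle i j : q i j <= (1 - th) * hs i j.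
  rewrite ler_pdivrMr ?ltr0Sn// Num.Theory.truncn_le.
  by apply: mulr_ge0 => //; apply: mulr_ge0.
have qge i j : (1 - th) * hs i j - th <= q i j.
  rewrite ler_pdivlMr ?ltr0Sn// mulrBl [th * _]mulVf ?pnatr_eq0// lerBlDr natr1.
  exact/ltW/truncnS_gt.
have sumw : \sum_i \sum_j hs i j * b j * a i = 1.
  by under eq_bigr do under eq_bigr do rewrite hsw; under eq_bigr do rewrite wa.
have sumba : \sum_i \sum_j b j * a i = 1.
  by under eq_bigr do rewrite -mulr_suml b1 mul1r.
have dge : th <= defect q.
  rewrite /defect lerBrDr -lerBrDl -[leRHS]mulr1 -[X in _ * X]sumw mulr_sumr.
  apply: ler_sum => i _; rewrite mulr_sumr; apply: ler_sum => j _.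
  rewrite !mulrA; apply: ler_wpM2r => //; apply: ler_wpM2r => //.
  by have := qle i j; rewrite [X in _ <= X]mulrA.
have dle : defect q <= 2 * th.
  rewrite /defect lerBlDr -lerBlDl.
  apply: (@le_trans _ _ (\sum_i \sum_j ((1 - th) * hs i j - th) * b j * a i)).
    rewrite [leRHS](_ : _ = \sum_i \sum_j ((1 - th) * (hs i j * b j * a i)
        - th * (b j * a i))); last first.
      by apply: eq_bigr => i _; apply: eq_bigr => j _; ring.
    under eq_bigr do rewrite sumrB -!mulr_sumr.
    by rewrite sumrB -!mulr_sumr sumw sumba; lra.
  apply: ler_sum => i _; apply: ler_sum => j _.
  by apply: ler_wpM2r => //; apply: ler_wpM2r => //.
have qs : subcoupling q.
  rewrite /subcoupling (lt_le_trans th0 dge) andbT.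
  apply/andP; split; apply/forallP => k.
    rewrite (le_trans _ (hsr k))//; apply: ler_sum => j _.
    apply: ler_wpM2r => //; rewrite (le_trans (qle k j))// ler_piMl// lerBlDr lerDl.
    exact: ltW.
  rewrite (le_trans _ (hsc k))//; apply: ler_sum => i _.
  apply: ler_wpM2r => //; rewrite (le_trans (qle i k))// ler_piMl// lerBlDr lerDl.
  exact: ltW.
exists N, n; split => //.
rewrite (le_trans (cost_completion qs FM))// lerD//.
  apply: ler_sum => i _; apply: ler_sum => j _.
  apply: ler_wpM2l => //; rewrite -hsw; apply: ler_wpM2r => //; apply: ler_wpM2r => //.
  rewrite (le_trans (qle i j))// ler_piMl// lerBlDr lerDl; exact: ltW.
rewrite (le_trans (ler_wpM2l M0 dle))// /th mulrCA mulrA ler_pdivrMr//.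
by have := ltW NM; rewrite ler_pdivrMr// [e * _]mulrC.
Qed.

End completion.

Lemma measurable_select {d d'} {T : measurableType d} {S : measurableType d'}
    (f : T -> nat) (g : nat -> T -> S) :
  measurable_fun [set: T] f -> (forall n, measurable_fun [set: T] (g n)) ->
  measurable_fun [set: T] (fun t => g (f t) t).
Proof.
move=> mf mg _ B mB; rewrite setTI.
rewrite (_ : _ @^-1` B = \bigcup_n (f @^-1` [set n] `&` g n @^-1` B)).
  apply: bigcupT_measurable => n; apply: measurableI.
    by rewrite -[X in measurable X]setTI; exact: mf.
  by rewrite -[X in measurable X]setTI; exact: mg.
apply/seteqP; split=> t /=; first by exists (f t).
by move=> [n _ [/= <-]].
Qed.

(** The inverse, with value 0 at 0, is pieced together from the real power of exponent -1 on the two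
    half-lines. *)
Lemma measurable_funV {d} {T : measurableType d} {R : realType} (f : T -> R) :
  measurable_fun [set: T] f -> measurable_fun [set: T] (fun t => (f t)^-1).
Proof.
move=> mf.
have -> : (fun t => (f t)^-1) =
    fun t => if 0 <= f t then f t `^ (-1) else - ((- f t) `^ (-1)).
  apply/funext => t; case: ifPn => [f0|]; first by rewrite powR_inv1.
  by rewrite -ltNge => f0; rewrite powR_inv1 ?oppr_ge0 ?ltW// invrN opprK.
apply: measurable_fun_ifT; first exact: measurable_fun_ler.
  exact: measurableT_comp (measurable_powR (-1)) mf.
apply: measurable_funN.
by apply: measurableT_comp (measurable_powR (-1)) _; exact: measurable_funN.
Qed.

Lemma measurable_fun_forall {d} {T : measurableType d} {I : finType}
    (g : I -> T -> bool) : (forall i, measurable_fun [set: T] (g i)) ->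
  measurable_fun [set: T] (fun t => [forall i, g i t]).
Proof.
move=> mg; apply: (measurable_fun_bool true); rewrite setTI.
rewrite (_ : _ @^-1` _ = \bigcap_(i in [set: I]) g i @^-1` [set true]).
  apply: fin_bigcap_measurable => // i _.
  by rewrite -[X in measurable X]setTI; exact: mg.
apply/seteqP; split=> t /=; first by move=> /forallP h i _; exact: h.
by move=> h; apply/forallP => i; exact: h.
Qed.

(** * Measurable selection of a near-optimal finite plan *)

Section measurable_plan.
Context {d} {Y : measurableType d} {R : realType} {I J : finType}.
Variables (a : I -> R) (b : J -> Y -> R) (F : I -> J -> Y -> R).
Hypothesis a0 : forall i, 0 <= a i.
Hypothesis b0 : forall j y, 0 <= b j y.
Hypothesis a1 : \sum_i a i = 1.
Hypothesis b1 : forall y, \sum_j b j y = 1.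
Hypothesis F0 : forall i j y, 0 <= F i j y.
Hypothesis mb : forall j, measurable_fun [set: Y] (b j).
Hypothesis mF : forall i j, measurable_fun [set: Y] (F i j).

(* The candidate densities are enumerated independently of [y], so the first index
   that does the job depends measurably on [y]. *)
Let grid (n : nat) (i : I) (j : J) : R :=
  if (unpickle n : option ({ffun I * J -> nat} * nat)) is Some p
  then (p.1 (i, j))%:R / p.2.+1%:R else 0.

Let grid_ge0 n i j : 0 <= grid n i j.
Proof. by rewrite /grid; case: unpickle => // p; rewrite divr_ge0. Qed.

Let ok n y := subcoupling a (b ^~ y) (grid n).
Let plan n y i j := completion a (b ^~ y) (grid n) i j.
Let val n y := cost a (b ^~ y) (fun i j => F i j y) (plan n y).

Let mrow n i : measurable_fun [set: Y] (fun y => row_mass (b ^~ y) (grid n) i).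
Proof.
by apply: measurable_sum => j; apply: measurable_funM => //; exact: mb.
Qed.

Let mdefect n : measurable_fun [set: Y] (fun y => defect a (b ^~ y) (grid n)).
Proof.
apply: measurable_funB => //; apply: measurable_sum => i.
apply: measurable_sum => j; apply: measurable_funM => //.
by apply: measurable_funM => //; exact: mb.
Qed.

Let mcol n j : measurable_fun [set: Y] (fun y => col_mass a (grid n) j).
Proof. exact: measurable_cst. Qed.

Let mplan n i j : measurable_fun [set: Y] (fun y => plan n y i j).
Proof.
apply: measurable_funD => //; apply: measurable_funM; last exact: measurable_funV.
by apply: measurable_funM => //; apply: measurable_funB => //; exact: mrow.
Qed.

Let mok n : measurable_fun [set: Y] (ok n).
Proof.
rewrite /ok /subcoupling; apply: measurable_and; last first.
  by apply: measurable_fun_ltr => //; exact: mdefect.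
apply: measurable_and.
  apply: measurable_fun_forall => i.
  by apply: measurable_fun_ler => //; exact: mrow.
by apply: measurable_fun_forall => j; exact: measurable_fun_ler.
Qed.

Let mval n : measurable_fun [set: Y] (val n).
Proof.
apply: measurable_sum => i; apply: measurable_sum => j.
apply: measurable_funM; first exact: mF.
apply: measurable_funM => //; apply: measurable_funM; last exact: mb.
exact: mplan.
Qed.

(** The zero density passes the test for every [y]; its completion is the product coupling. *)
Let ok0 : exists n, forall y, ok n y.
Proof.
exists (pickle ([ffun _ : I * J => 0%N], 0%N)) => y; rewrite /ok.
have -> : grid (pickle ([ffun _ : I * J => 0%N], 0%N)) = fun _ _ => 0.
  by apply/funext => i; apply/funext => j; rewrite /grid pickleK/= ffunE mul0r.
rewrite /subcoupling /row_mass /col_mass /defect.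
apply/andP; split; first (apply/andP; split); [apply/forallP => k|apply/forallP => k|].
- by rewrite big1 ?ler01// => i _; rewrite mul0r.
- by rewrite big1 ?ler01// => i _; rewrite mul0r.
- by rewrite big1 ?subr0// => i _; rewrite big1// => j _; rewrite !mul0r.
Qed.

(** Half of [e] pays for taking a candidate almost best among all candidates, the other half for
    approximating an arbitrary plan [w] by a candidate. Comparison with all candidates is a
    countable condition on [y]. *)
Lemma measurable_near_optimal_plan e : 0 < e ->
  exists h : I -> J -> Y -> R,
  [/\ forall i j, measurable_fun [set: Y] (h i j),
      forall i j y, 0 <= h i j y,
      forall i y, \sum_j h i j y * b j y = 1,
      forall j y, \sum_i h i j y * a i = 1 &
      forall y (w : I -> J -> R), (forall i j, 0 <= w i j) ->
        (forall i, \sum_j w i j = a i) -> (forall j, \sum_i w i j = b j y) ->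
        cost a (b ^~ y) (fun i j => F i j y) (fun i j => h i j y) <=
        \sum_i \sum_j F i j y * w i j + e].
Proof.
move=> e0; have e20 : 0 < e / 2 by rewrite divr_gt0.
pose E n := [set y | ok n y] `&`
  \bigcap_m [set y | ok m y ==> (val n y <= val m y + e / 2)].
have [f mf fP] : exists2 f : Y -> nat, measurable_fun [set: Y] f &
    forall t, (exists n, E n t) -> E (f t) t /\ forall n, (n < f t)%N -> ~ E n t.
  apply: measurable_first => n; apply: measurableI.
    by have := @mok n measurableT [set true] Logic.I; rewrite setTI.
  apply: bigcapT_measurable => m.
  have h : measurable_fun [set: Y] (fun y => ~~ ok m y || (val n y <= val m y + e / 2)).
    apply: measurable_or; first by apply: measurable_neg; exact: mok.
    apply: measurable_fun_ler; first exact: mval.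
    by apply: measurable_funD => //; exact: mval.
  have := h measurableT [set true] Logic.I; rewrite setTI.
  congr (measurable _); apply/seteqP; split=> y /=; rewrite implybE//.
have Ef y : E (f y) y.
  suff /fP[] : exists n, E n y by [].
  pose V := [set val n y | n in [set n | ok n y]].
  have [n0 n0P] := ok0.
  have V0 : has_inf V.
    split; first by exists (val n0 y); exists n0 => //; exact: n0P.
    exists 0 => _ [n nok <-]; rewrite /val /cost sumr_ge0// => i _.
    rewrite sumr_ge0// => j _; rewrite mulr_ge0// mulr_ge0// mulr_ge0//.
    by apply: completion_ge0 => //; exact: nok.
  have [_ [n nok <-] nV] := inf_adherent e20 V0.
  exists n; split => // m _ /=; apply/implyP => mok'.
  rewrite (le_trans (ltW nV))// lerD2r; apply: ge_inf; first exact: V0.2.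
  by exists m.
exists (fun i j y => plan (f y) y i j); split.
- move=> i j; apply: (@measurable_select _ _ _ _ f (fun n y => plan n y i j)) => //.
- by move=> i j y; have [fok _] := Ef y; exact: completion_ge0.
- by move=> i y; have [fok _] := Ef y; exact: completion_row.
- by move=> j y; have [fok _] := Ef y; exact: completion_col.
move=> y w w0 wa wb; have [_ /= fle] := Ef y.
have [N [n /= [qs qle]]] := grid_approximation a0 (b0 ^~ y) a1 (b1 y)
  (fun i j => F0 i j y) w0 wa wb e20.
pose m := pickle ([ffun p : I * J => n p.1 p.2], N).
have mE : grid m = fun i j => (n i j)%:R / N.+1%:R.
  by apply/funext => i; apply/funext => j; rewrite /grid /m pickleK/= ffunE.
have okm : ok m y by rewrite /ok mE.
have vm : val m y <= \sum_i \sum_j F i j y * w i j + e / 2.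
  by rewrite /val /plan mE.
have := fle m Logic.I; rewrite /= okm/= => /le_trans; apply.
by rewrite [leRHS](_ : _ = \sum_i \sum_j F i j y * w i j + e / 2 + e / 2) ?lerD2r//;
  rewrite -addrA -splitr.
Qed.

End measurable_plan.

(** * The fiberwise lower bound *)

Section integral_code.
Context {d} {T : measurableType d} {R : realType} {I : finType} (c : T -> I).
Hypothesis mc : forall i, measurable (c @^-1` [set i]).
Variable phi : I -> R.
Hypothesis phi0 : forall i, 0 <= phi i.

Let code_sum t :
  (phi (c t))%:E = (\sum_i (phi i)%:E * (\1_(c @^-1` [set i]) t)%:E)%E.
Proof.
rewrite (bigD1 (c t))//= big1 ?adde0.
  by rewrite indicE mem_set//= mule1.
move=> i ict; rewrite indicE memNset ?mule0//= => cti.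
by rewrite cti eqxx in ict.
Qed.

Lemma measurable_code : measurable_fun [set: T] (fun t => (phi (c t))%:E).
Proof.
under eq_fun do rewrite code_sum.
apply: emeasurable_sum => i; apply: measurable_funeM.
by apply/measurable_EFinP; exact: measurable_indic.
Qed.

Lemma integral_code (P : probability T R) :
  (\int[P]_t (phi (c t))%:E =
   (\sum_i phi i * fine (P (c @^-1` [set i])))%:E)%E.
Proof.
under eq_integral do rewrite code_sum.
rewrite ge0_integral_sum//; last 2 first.
- move=> i; apply: measurable_funeM.
  by apply/measurable_EFinP; exact: measurable_indic.
- by move=> i t _; rewrite mule_ge0// lee_fin.
rewrite -sumEFin; apply: eq_bigr => i _.
rewrite ge0_integralZl//; last 2 first.
- by apply/measurable_EFinP; exact: measurable_indic.
- by rewrite lee_fin.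
by rewrite integral_indic// setIT EFinM fineK// fin_num_measure.
Qed.

Lemma integral_density_code (P Q : probability T R) (H : T -> \bar R) :
  measurable_fun [set: T] H -> (forall t, (0 <= H t)%E) ->
  (forall A, measurable A -> Q A = (\int[P]_(t in A) H t)%E) ->
  (\int[Q]_t (phi (c t))%:E = \int[P]_t ((phi (c t))%:E * H t))%E.
Proof.
move=> mH H0 QH; rewrite integral_code.
have mterm i : measurable_fun [set: T]
    (fun t => ((\1_(c @^-1` [set i]) t)%:E * H t)%E).
  apply: emeasurable_funM => //.
  by apply/measurable_EFinP; exact: measurable_indic.
under [RHS]eq_integral => t _.
  rewrite code_sum ge0_sume_distrl; last by move=> i _; rewrite mule_ge0// lee_fin.
  under eq_bigr do rewrite -muleA.
  over.
rewrite /= ge0_integral_sum//; last 2 first.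
- by move=> i; exact: measurable_funeM.
- by move=> i t _; rewrite mule_ge0// ?lee_fin// mule_ge0// lee_fin.
rewrite -sumEFin; apply: eq_bigr => i _.
rewrite ge0_integralZl//; last 2 first.
- by move=> t _; rewrite mule_ge0// lee_fin.
- by rewrite lee_fin.
rewrite EFinM fineK ?fin_num_measure// QH//.
congr (_ * _)%E; rewrite [LHS]integral_mkcond; apply: eq_integral => t _; rewrite patchE indicE.
by case: ifPn; rewrite ?mul1e ?mul0e.
Qed.

End integral_code.

Lemma sum_code {d} {T : measurableType d} {R : realType} {I : finType}
    (c : T -> I) (P : probability T R) :
  (forall i, measurable (c @^-1` [set i])) ->
  \sum_i fine (P (c @^-1` [set i])) = 1.
Proof.
move=> mc; apply/EFin_inj.
have := @integral_code _ _ _ _ c mc (fun=> 1) (fun=> ler01) P.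
rewrite integral_cst// mul1e => P1; have {}P1 := etrans (esym P1) (probability_setT P).
rewrite -[RHS]P1.
by congr _%:E; apply: eq_bigr => i _; rewrite mul1r.
Qed.

Lemma measurable_select_fin {d d'} {T : measurableType d} {S : measurableType d'}
    {I : finType} (c : T -> I) (g : I -> T -> S) :
  (forall i, measurable (c @^-1` [set i])) ->
  (forall i, measurable_fun [set: T] (g i)) ->
  measurable_fun [set: T] (fun t => g (c t) t).
Proof.
move=> mc mg _ B mB; rewrite setTI.
rewrite (_ : _ @^-1` B = \bigcup_(i in [set: I]) (c @^-1` [set i] `&` g i @^-1` B)).
  apply: fin_bigcup_measurable => // i _; apply: measurableI => //.
  by rewrite -[X in measurable X]setTI; exact: mg.
apply/seteqP; split=> t /=; first by exists (c t).
by move=> [i _ [/= <-]].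
Qed.

Lemma sum_code_setI {d} {T : measurableType d} {R : realType} {I : finType}
    (c : T -> I) (P : probability T R) (A : set T) :
  measurable A -> (forall i, measurable (c @^-1` [set i])) ->
  \sum_i fine (P (A `&` c @^-1` [set i])) = fine (P A).
Proof.
move=> mA mc.
have mAc i : measurable (A `&` c @^-1` [set i]) by exact: measurableI.
rewrite sum_fine; last by move=> i _; rewrite fin_num_measure.
congr fine; rewrite fsbig_seq ?index_enum_uniq// -measure_fin_bigcup//.
- congr (P _); apply/seteqP; split=> t; first by move=> [i _ []].
  by move=> At; exists (c t) => //=; rewrite mem_index_enum.
- by apply/trivIsetP => i j _ _ /eqP ij; apply/seteqP; split=> t //= [[_ ->]] [].
Qed.

Section fiberwise_bound.
Context {dY dU dV} {Y : measurableType dY} {U : measurableType dU}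
  {V : measurableType dV} {R : realType}.
Variables (nu : probability (Y * U)%type R) (alpha : probability V R).
Variable kap : Y -> probability U R.
Hypothesis kapP : is_cond_law nu fst snd kap.
Hypothesis stV : standard V.
Variables (K : nat -> finType) (cY : forall k, Y -> K k)
  (cV : forall k, V -> K k) (cU : forall k, U -> K k).
Hypothesis mcY : forall k i, measurable (cY k @^-1` [set i]).
Hypothesis mcV : forall k i, measurable (cV k @^-1` [set i]).
Hypothesis mcU : forall k i, measurable (cU k @^-1` [set i]).
Variable F : forall k, K k -> K k -> K k -> R.
Hypothesis F0 : forall k (e i j : K k), 0 <= F e i j.

Let f k y v u := F (cY k y) (cV k v) (cU k u).
Variable g : Y -> V -> U -> R.
Hypothesis f_nd : forall y v u, nondecreasing_seq (fun k => f k y v u).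
Hypothesis f_cvg : forall y v u, f k y v u @[k --> \oo] --> g y v u.

Let fg k y v u : f k y v u <= g y v u.
Proof.
have h := @nondecreasing_cvgn_le R _ (@f_nd y v u).
rewrite -(cvg_lim _ (@f_cvg y v u))//; apply: h.
by apply/cvg_ex; exists (g y v u).
Qed.

Let nuY := law nu measurable_fst.

Let integral_nu (h : Y * U -> \bar R) :
  measurable_fun [set: Y * U] h -> (forall x, 0 <= h x)%E ->
  (\int[nu]_x h x = \int[nuY]_y \int[kap y]_u h (y, u))%E.
Proof.
move=> mh h0.
have := integral_cond_law measurable_fst measurable_snd kapP mh h0.
by under eq_integral do rewrite -surjective_pairing.
Qed.

Let a k i := fine (alpha (cV k @^-1` [set i])).
Let b k j y := fine (kap y (cU k @^-1` [set j])).
Let eps k : R := k.+1%:R^-1.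

Let plan_exists : exists h : forall k, K k -> K k -> Y -> R, forall k,
  [/\ forall i j, measurable_fun [set: Y] (@h k i j),
      forall i j y, 0 <= @h k i j y,
      forall i y, \sum_j @h k i j y * @b k j y = 1,
      forall j y, \sum_i @h k i j y * @a k i = 1 &
      forall y (w : K k -> K k -> R), (forall i j, 0 <= w i j) ->
        (forall i, \sum_j w i j = @a k i) -> (forall j, \sum_i w i j = @b k j y) ->
        cost (@a k) (@b k ^~ y) (F (cY k y)) (fun i j => @h k i j y) <=
        \sum_i \sum_j F (cY k y) i j * w i j + eps k].
Proof.
(* The type [K k] of the cells varies with [k], so this is a dependent choice. *)
suff /(_ _)/cid - /all_sig[h hP] : forall k, exists h : K k -> K k -> Y -> R,
  [/\ forall i j, measurable_fun [set: Y] (h i j),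
      forall i j y, 0 <= h i j y,
      forall i y, \sum_j h i j y * @b k j y = 1,
      forall j y, \sum_i h i j y * @a k i = 1 &
      forall y (w : K k -> K k -> R), (forall i j, 0 <= w i j) ->
        (forall i, \sum_j w i j = @a k i) -> (forall j, \sum_i w i j = @b k j y) ->
        cost (@a k) (@b k ^~ y) (F (cY k y)) (fun i j => h i j y) <=
        \sum_i \sum_j F (cY k y) i j * w i j + eps k] by exists h.
move=> k.
apply: (@measurable_near_optimal_plan _ Y R (K k) (K k) (@a k) (@b k)
  (fun i j y => F (cY k y) i j)) => //.
- by move=> i; exact: fine_ge0.
- by move=> j y; exact: fine_ge0.
- exact: sum_code.
- by move=> y; exact: sum_code.
- by move=> j; apply: measurableT_comp => //; exact: kapP.1.
- move=> i j; apply/measurable_EFinP.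
  exact: (@measurable_code _ _ _ _ _ (@mcY k) (fun e => @F k e i j)).
- by rewrite invr_gt0.
Qed.

Section plan.
Variable h : forall k, K k -> K k -> Y -> R.
Hypothesis mh : forall k (i j : K k), measurable_fun [set: Y] (@h k i j).
Hypothesis h0 : forall k (i j : K k) y, 0 <= @h k i j y.
Hypothesis h_row : forall k (i : K k) y, \sum_j @h k i j y * @b k j y = 1.
Hypothesis h_col : forall k (j : K k) y, \sum_i @h k i j y * @a k i = 1.

(** Density with respect to [nu \x alpha] of the coupling glued from the fiber plans. These are
    themselves densities with respect to the cell masses, so no division by a possibly null mass
    occurs. *)
Let H k (x : (Y * U) * V) := (@h k (cV k x.2) (cU k x.1.2) x.1.1)%:E.
Let ff k (x : (Y * U) * V) := (f k x.1.1 x.2 x.1.2)%:E.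
Let psi k y := cost (@a k) (@b k ^~ y) (@F k (cY k y)) (fun i j => @h k i j y).

Let mf2 k : forall i, measurable ((fun x : (Y * U) * V => cV k x.2) @^-1` [set i]).
Proof.
move=> i; rewrite (_ : _ @^-1` _ = setT `*` (cV k @^-1` [set i])).
  exact: measurableX.
by apply/seteqP; split=> x //= [].
Qed.

Let mf12 k : forall i, measurable ((fun x : (Y * U) * V => cU k x.1.2) @^-1` [set i]).
Proof.
move=> i; rewrite (_ : _ @^-1` _ = (setT `*` (cU k @^-1` [set i])) `*` setT).
  by apply: measurableX => //; exact: measurableX.
by apply/seteqP; split=> x //= [[]].
Qed.

Let mH k : measurable_fun setT (H k).
Proof.
apply/measurable_EFinP.
apply: (@measurable_select_fin _ _ _ _ _ _
  (fun i (x : (Y * U) * V) => @h k i (cU k x.1.2) x.1.1) (@mf2 k)) => i.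
apply: (@measurable_select_fin _ _ _ _ _ _
  (fun j (x : (Y * U) * V) => @h k i j x.1.1) (@mf12 k)) => j.
apply: measurableT_comp (@mh k i j) _.
exact: measurableT_comp measurable_fst measurable_fst.
Qed.

Let H0 k x : (0 <= H k x)%E. Proof. by rewrite lee_fin. Qed.

Let code k (x : (Y * U) * V) : K k * K k * K k :=
  (cY k x.1.1, cV k x.2, cU k x.1.2).
Let Fc k (t : K k * K k * K k) := F t.1.1 t.1.2 t.2.

Let codeE k e i j : code k @^-1` [set (e, i, j)] =
  ((cY k @^-1` [set e]) `*` (cU k @^-1` [set j])) `*` (cV k @^-1` [set i]).
Proof.
by apply/seteqP; split=> -[[y u] v]; rewrite /code /= => -[]; [move=> <- <- <-|
  move=> [-> ->] ->].
Qed.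

Let mcode k t : measurable (code k @^-1` [set t]).
Proof.
by move: t => [[e i] j]; rewrite codeE; apply: measurableX => //; exact: measurableX.
Qed.

Lemma measurable_ff k : measurable_fun setT (ff k).
Proof. exact: (@measurable_code _ _ _ _ _ (@mcode k) (@Fc k)). Qed.

Let ff0 k x : (0 <= ff k x)%E. Proof. by rewrite lee_fin F0. Qed.

Let integral_row k i y : (\int[kap y]_u (@h k i (cU k u) y)%:E = 1)%E.
Proof.
rewrite (@integral_code _ _ _ _ _ (@mcU k) (fun j => @h k i j y))//.
by congr _%:E; exact: h_row.
Qed.

Let integral_col k j y : (\int[alpha]_v (@h k (cV k v) j y)%:E = 1)%E.
Proof.
rewrite (@integral_code _ _ _ _ _ (@mcV k) (fun i => @h k i j y))//.
by congr _%:E; exact: h_col.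
Qed.

Let integral_H k : (\int[nu \x alpha]_x H k x = 1)%E.
Proof.
rewrite fubini_tonelli1//; rewrite /fubini_F.
rewrite (eq_integral (cst 1%E)); last first.
  by move=> x _; exact: (@integral_col k (cU k x.2) x.1).
by rewrite integral_cst// mul1e; exact: (probability_setT nu).
Qed.

Let integral_ffH k :
  (\int[nu \x alpha]_x (ff k x * H k x) = \int[nuY]_y (psi k y)%:E)%E.
Proof.
have mfH : measurable_fun setT (fun x => ff k x * H k x)%E.
  exact: emeasurable_funM (@measurable_ff k) (@mH k).
have fH0 x : (0 <= ff k x * H k x)%E by exact: mule_ge0.
rewrite fubini_tonelli1// integral_nu; last 2 first.
- exact: measurable_fun_fubini_tonelli_F.
- by move=> x; apply: integral_ge0 => v _.
apply: eq_integral => y _; rewrite /fubini_F.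
rewrite (eq_integral (fun u =>
    (\sum_i F (cY k y) i (cU k u) * @h k i (cU k u) y * @a k i)%:E)); last first.
  move=> u _; rewrite -(@integral_code _ _ _ _ _ (@mcV k)
    (fun i => F (cY k y) i (cU k u) * @h k i (cU k u) y))//.
  by move=> i; rewrite mulr_ge0.
rewrite (@integral_code _ _ _ _ _ (@mcU k)
  (fun j => \sum_i F (cY k y) i j * @h k i j y * @a k i)); last first.
  by move=> j; rewrite sumr_ge0// => i _; rewrite !mulr_ge0// fine_ge0.
congr _%:E; rewrite /psi /cost exchange_big; apply: eq_bigr => j _.
rewrite mulr_suml; apply: eq_bigr => i _; rewrite -/(@b k j y).
by rewrite -!mulrA; congr (_ * (_ * _)); rewrite mulrC.
Qed.

(** Integrating the density over [v] gives 1 by the column condition, hence the marginal [nu];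
    integrating it over [u] gives 1 by the row condition, hence [v] has law [alpha] and is
    independent of [y]. *)
Lemma near_optimal_coupling k : exists Q : probability ((Y * U) * V)%type R,
  [/\ forall B, measurable B -> Q (B `*` setT) = nu B,
      forall B A, measurable B -> measurable A ->
        Q ((B `*` setT) `*` A) = (nuY B * alpha A)%E &
      forall l, (l <= k)%N ->
        (\int[Q]_x ff l x <= \int[nuY]_y (psi k y)%:E)%E].
Proof.
have [Q QH] := density_probability (@mH k) (@H0 k) (integral_H k).
have mind d (T : measurableType d) (A : set T) : measurable A ->
    measurable_fun setT (fun x => (\1_A x)%:E : \bar R).
  by move=> mA; apply/measurable_EFinP; exact: measurable_indic.
have mW B A : measurable B -> measurable A -> measurable_fun setT
    (fun x : (Y * U) * V => (\1_B x.1)%:E * ((\1_A x.2)%:E * H k x))%E.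
  move=> mB mA; apply: emeasurable_funM.
    exact: measurableT_comp (mind _ _ _ mB) measurable_fst.
  apply: emeasurable_funM => //.
  exact: measurableT_comp (mind _ _ _ mA) measurable_snd.
have W0 B A (x : (Y * U) * V) :
    (0 <= (\1_B x.1)%:E * ((\1_A x.2)%:E * H k x))%E.
  by rewrite !mule_ge0// lee_fin.
have QE B A : measurable B -> measurable A -> Q (B `*` A) =
    (\int[nu \x alpha]_x ((\1_B x.1)%:E * ((\1_A x.2)%:E * H k x)))%E.
  move=> mB mA; rewrite QH; last exact: measurableX.
  rewrite [LHS]integral_mkcond; apply: eq_integral => x _.
  rewrite patchE !indicE in_setX.
  by case: (x.1 \in B); case: (x.2 \in A); rewrite /= ?mul1e ?mul0e.
exists Q; split.
- move=> B mB; rewrite QE// fubini_tonelli1; [|exact: mW|by move=> ?; exact: W0].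
  transitivity (\int[nu]_x (\1_B x)%:E)%E; last first.
    by rewrite integral_indic// setIT.
  apply: eq_integral => x _.
  rewrite /fubini_F/= ge0_integralZl//; last 2 first.
  + apply: emeasurable_funM; first exact: mind.
    exact: measurableT_comp (@mH k) (measurable_pair1 x).
  + by move=> v _; rewrite mule_ge0// lee_fin.
  under eq_integral do rewrite indicT mul1e.
  by rewrite [X in (_ * X)%E](@integral_col k (cU k x.2) x.1) mule1.
- move=> B A mB mA.
  have mBT : measurable (B `*` [set: U]) by exact: measurableX.
  rewrite QE// fubini_tonelli2; [|exact: mW|by move=> ?; exact: W0].
  transitivity (\int[alpha]_v (nuY B * (\1_A v)%:E))%E; last first.
    rewrite ge0_integralZl//; last exact: mind.
    by rewrite integral_indic// setIT.
  apply: eq_integral => v _; rewrite /fubini_G integral_nu; last 2 first.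
  + exact: measurableT_comp (mW _ _ mBT mA) (measurable_pair2 v).
  + by move=> x; exact: (W0 _ _ (x, v)).
  rewrite (_ : nuY B = \int[nuY]_y (\1_B y)%:E)%E; last first.
    by rewrite integral_indic// setIT.
  rewrite -ge0_integralZr//; last exact: mind.
  apply: eq_integral => y _ /=.
  rewrite (eq_integral (fun u => ((\1_B y)%:E * (\1_A v)%:E) *
      (@h k (cV k v) (cU k u) y)%:E)%E); last first.
    move=> u _; rewrite muleA; congr (_%:E * _ * _)%E.
    by rewrite !indicE in_setX in_setT andbT.
  rewrite ge0_integralZl//; last 2 first.
  + exact: (@measurable_code _ _ _ _ _ (@mcU k) (fun j => @h k (cV k v) j y)).
  + by move=> u _; rewrite lee_fin.
  by rewrite integral_row mule1.
- move=> l lk; rewrite -integral_ffH.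
  rewrite (@integral_density_code _ _ _ _ _ (@mcode l) (@Fc l) _ (nu \x alpha)%E _ (H k))//.
  apply: ge0_le_integral => //.
  + by move=> x _; rewrite mule_ge0// lee_fin F0.
  + exact: emeasurable_funM (@measurable_ff l) (@mH k).
  + exact: emeasurable_funM (@measurable_ff k) (@mH k).
  + by move=> x _; rewrite lee_wpmul2r// lee_fin; exact: f_nd.
- by move=> [[e i] j]; exact: F0.
Qed.

Lemma measurable_psi k : measurable_fun setT (psi k).
Proof.
apply: measurable_sum => i; apply: measurable_sum => j.
apply: measurable_funM.
  apply/measurable_EFinP.
  exact: (@measurable_code _ _ _ _ _ (@mcY k) (fun e => @F k e i j)).
apply: measurable_funM => //; apply: measurable_funM; first exact: mh.
by apply: measurableT_comp => //; exact: kapP.1.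
Qed.

Lemma psi_ge0 k y : 0 <= psi k y.
Proof.
rewrite /psi /cost sumr_ge0// => i _; rewrite sumr_ge0// => j _.
by rewrite !mulr_ge0// fine_ge0.
Qed.

Let f_integral (Q : probability ((Y * U) * V)%type R) l :
  (\int[Q]_x ff l x =
   (\sum_t Fc t * fine (Q (code l @^-1` [set t])))%:E)%E.
Proof.
by apply: (@integral_code _ _ _ _ _ (@mcode l) (@Fc l)) => -[[e i] j]; exact: F0.
Qed.

(** With [l] fixed, the integral of [ff l] is a finite combination of masses of rectangles and
    passes to the limit, while [eps k] vanishes. The two marginal conditions concern rectangles and
    are constant along the sequence. *)
Lemma ultralimit_near_optimal (r : R) :
  (forall k, (\int[nuY]_y (psi k y)%:E <= (r + eps k)%:E)%E) ->
  exists Q : probability ((Y * U) * V)%type R,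
  [/\ forall B, measurable B -> Q (B `*` setT) = nu B,
      forall B A, measurable B -> measurable A ->
        Q ((B `*` setT) `*` A) = (nuY B * alpha A)%E &
      forall l, (\int[Q]_x ff l x <= r%:E)%E].
Proof.
move=> psir; have /choice[Q_ QP] := near_optimal_coupling.
have Qfst k B : measurable B -> Q_ k (B `*` setT) = nu B by have [+ _ _] := QP k; apply.
have Qpair k B A : measurable B -> measurable A ->
    Q_ k ((B `*` setT) `*` A) = (nuY B * alpha A)%E.
  by have [_ + _] := QP k; apply.
have Qsnd k A : measurable A -> Q_ k (setT `*` A) = alpha A.
  by move=> mA; rewrite -setXTT Qpair// (probability_setT nuY) mul1e.
(* The ultrafilter refines the filter of tails, so bounds that hold only for [k] at least [l]
   survive in the limit. *)
have [W [UW oW]] := ultraFilterLemma (@eventually_filter).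
have [Q Qlim] := ultralimit_coupling UW stV Qfst Qsnd.
have fin (P : probability ((Y * U) * V)%type R) A : measurable A -> P A \is a fin_num.
  by move=> mA; exact: fin_num_measure.
have limE B A (z : \bar R) : measurable B -> measurable A -> z \is a fin_num ->
    (forall k, Q_ k (B `*` A) = z) -> Q (B `*` A) = z.
  move=> mB mA zfin Qz; have mBA : measurable (B `*` A) by exact: measurableX.
  rewrite -(fineK (fin Q _ mBA)) -(fineK zfin); congr _%:E.
  have := Qlim B A mB mA; under eq_fun do rewrite Qz.
  by move/cvg_lim => <- //; exact: lim_cst.
exists Q; split.
- move=> B mB; apply: limE => //; last by move=> k; exact: Qfst.
  exact: fin_num_measure.
- move=> B A mB mA; apply: limE => //; [exact: measurableX| |by move=> k; exact: Qpair].
  by rewrite fin_numM// fin_num_measure.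
move=> l; rewrite f_integral lee_fin.
have lhs : \sum_t Fc t * fine (Q_ k (code l @^-1` [set t])) @[k --> W] -->
    \sum_t Fc t * fine (Q (code l @^-1` [set t])).
  apply: cvg_bigsum => -[[e i] j]; apply: cvgM; first exact: cvg_cst.
  by rewrite codeE; apply: Qlim => //; exact: measurableX.
have rhs : r + eps k @[k --> W] --> r.
  apply: (@cvg_trans _ ((r + eps k) @[k --> \oo])).
    by move=> A; exact: oW.
  suff : r + eps k @[k --> \oo] --> r + 0 by rewrite addr0.
  by apply: cvgD; [exact: cvg_cst|exact: cvg_harmonic].
apply: (ler_cvg_to lhs rhs); apply: oW; exists l => // k /= lk.
have [_ _ /(_ l lk)] := QP k; rewrite f_integral => h1.
by rewrite -lee_fin (le_trans h1).
Qed.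

End plan.

Lemma fiberwise_bound : exists m : Y -> \bar R,
  [/\ measurable_fun setT m, forall y, (0 <= m y)%E,
      forall y (p : probability (V * U)%type R), couplings alpha (kap y) p ->
        (m y <= \int[p]_w (g y w.1 w.2)%:E)%E &
      (\int[nuY]_y m y < +oo)%E ->
      exists Q : probability ((Y * U) * V)%type R,
      [/\ forall B, measurable B -> Q (B `*` setT) = nu B,
          forall B A, measurable B -> measurable A ->
            Q ((B `*` setT) `*` A) = (nuY B * alpha A)%E &
          (\int[Q]_x (g x.1.1 x.2 x.1.2)%:E <= \int[nuY]_y m y)%E]].
Proof.
have [h hP] := plan_exists.
have mh k (i j : K k) : measurable_fun [set: Y] (@h k i j) by have [+ _ _ _ _] := hP k.
have h0 k (i j : K k) y : 0 <= @h k i j y by have [_ + _ _ _] := hP k.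
have h_row k (i : K k) y : \sum_j @h k i j y * @b k j y = 1 by have [_ _ + _ _] := hP k.
have h_col k (j : K k) y : \sum_i @h k i j y * @a k i = 1 by have [_ _ _ + _] := hP k.
pose psi k y := cost (@a k) (@b k ^~ y) (@F k (cY k y)) (fun i j => @h k i j y).
have mpsi k : measurable_fun setT (psi k) by exact: measurable_psi.
(* The selected plan may exceed the optimum by [eps k]; subtracting this gives a lower bound, and
   truncation at 0 keeps it nonnegative. *)
pose n y k : \bar R := (Num.max 0 (psi k y - eps k))%:E.
have mn k : measurable_fun setT (n ^~ k).
  apply/measurable_EFinP; apply: measurable_maxr => //.
  exact: measurable_funB.
pose m y := esups (n y) 0.
have nm y k : (n y k <= m y)%E by apply: ereal_sup_ubound; exists k.
have mm : measurable_fun setT m by exact: measurable_fun_esups.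
have m0 y : (0 <= m y)%E.
  by rewrite (le_trans _ (nm y 0%N))// lee_fin le_max lexx.
have mc1 k i : measurable ((fun w : V * U => cV k w.1) @^-1` [set i]).
  rewrite (_ : _ @^-1` _ = (cV k @^-1` [set i]) `*` setT).
    exact: measurableX.
  by apply/seteqP; split=> x //= [].
have mc2 k j : measurable ((fun w : V * U => cU k w.2) @^-1` [set j]).
  rewrite (_ : _ @^-1` _ = setT `*` (cU k @^-1` [set j])).
    exact: measurableX.
  by apply/seteqP; split=> x //= [].
have mf k y : measurable_fun setT (fun w : V * U => f k y w.1 w.2).
  apply: (@measurable_select_fin _ _ _ _ _ (fun w : V * U => cV k w.1)
    (fun i w => F (cY k y) i (cU k w.2))) => // i.
  by apply: (@measurable_select_fin _ _ _ _ _ (fun w : V * U => cU k w.2)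
    (fun j _ => F (cY k y) i j)).
exists m; split=> //.
- move=> y p [p1 p2].
  have mg : measurable_fun setT (fun w : V * U => g y w.1 w.2).
    apply: (measurable_fun_cvg (fun k => mf k y)) => w _; exact: f_cvg.
  have g0 w : 0 <= g y w.1 w.2 by rewrite (le_trans _ (fg 0%N y _ _))// F0.
  apply: ge_ereal_sup => _ [k _ <-]; rewrite /n EFin_max ge_max.
  rewrite integral_ge0//=; last by move=> w _; rewrite lee_fin.
  (* The masses that [p] gives to the cells compete in the finite problem for which [h] is
     near-optimal. *)
  pose w (i j : K k) := fine (p ((cV k @^-1` [set i]) `*` (cU k @^-1` [set j]))).
  have opt : psi k y <= \sum_i \sum_j F (cY k y) i j * w i j + eps k.
    have [_ _ _ _] := hP k; apply.
    + by move=> i j; exact: fine_ge0.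
    + move=> i; rewrite /w /a -(p1 _ (mcV i)).
      have mi : measurable ((fst : V * U -> V) @^-1` (cV k @^-1` [set i])).
        by rewrite -[X in measurable X]setTI; exact: measurable_fst.
      exact: (@sum_code_setI _ _ _ _ (fun w : V * U => cU k w.2) p _ mi (@mc2 k)).
    + move=> j; rewrite /w /b -(p2 _ (mcU j)).
      have mj : measurable ((snd : V * U -> U) @^-1` (cU k @^-1` [set j])).
        by rewrite -[X in measurable X]setTI; exact: measurable_snd.
      rewrite -[RHS](@sum_code_setI _ _ _ _ (fun w : V * U => cV k w.1) p _ mj (@mc1 k)).
      by apply: eq_bigr => i _; rewrite setIC.
  rewrite EFinB leeBlDr//.
  apply: (@le_trans _ _ (\int[p]_w (f k y w.1 w.2)%:E + (eps k)%:E)%E).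
    pose cVU (w : V * U) := (cV k w.1, cU k w.2).
    have cE i j : cVU @^-1` [set (i, j)] = (cV k @^-1` [set i]) `*` (cU k @^-1` [set j]).
      by apply/seteqP; split=> -[v u]; rewrite /cVU /=; [move=> [-> ->]|move=> [-> ->]].
    have mcVU t : measurable (cVU @^-1` [set t]).
      by case: t => i j; rewrite cE; exact: measurableX.
    have := @integral_code _ _ _ _ cVU mcVU (fun t => F (cY k y) t.1 t.2) _ p.
    rewrite /f/= => ->; last by move=> t; exact: F0.
    rewrite lee_fin (le_trans opt)// lerD2r pair_bigA/=.
    by rewrite le_eqVlt; apply/orP; left; apply/eqP; apply: eq_bigr => -[i j] _ /=; rewrite cE.
  apply: leeD2r; apply: ge0_le_integral => //.
  + by move=> x _; rewrite lee_fin F0.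
  + exact/measurable_EFinP.
  + exact/measurable_EFinP.
  + by move=> x _; rewrite lee_fin.
move=> moo.
(* The limit bound is stated with a real number, so the integral of [m] has to be finite. *)
have mfin : (\int[nuY]_y m y)%E \is a fin_num by rewrite ge0_fin_numE// integral_ge0.
have [|Q [Q1 Q2 Q3]] := ultralimit_near_optimal mh h0 h_row h_col
    (r := fine (\int[nuY]_y m y)%E).
  move=> k; rewrite EFinD fineK//.
  rewrite -[X in (_ + X)%E]mule1 -(probability_setT nuY) -integral_cst//.
  rewrite -ge0_integralD//; last first.
    by move=> y _; rewrite lee_fin invr_ge0.
  apply: ge0_le_integral => //.
  + by move=> y _; rewrite lee_fin psi_ge0.
  + by apply/measurable_EFinP; exact: measurable_psi.
  + by apply: emeasurable_funD.
  + move=> y _; rewrite -leeBlDr// (le_trans _ (nm y k))// lee_fin le_max.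
    by rewrite lexx orbT.
exists Q; split=> //.
rewrite (_ : (\int[Q]_x _)%E = (\int[Q]_x limn (fun l => (f l x.1.1 x.2 x.1.2)%:E))%E); last first.
  apply: eq_integral => x _; apply/esym/cvg_lim => //.
  by apply: cvg_EFin; [exact: nearW|exact: f_cvg].
rewrite monotone_convergence//; last 3 first.
- by move=> l; exact: measurable_ff.
- by move=> l x _; rewrite lee_fin F0.
- by move=> x _ k l kl; rewrite lee_fin; exact: f_nd.
apply: lime_le.
  apply: ereal_nondecreasing_is_cvgn => k l kl; apply: ge0_le_integral => //.
  + by move=> x _; rewrite lee_fin F0.
  + exact: measurable_ff.
  + exact: measurable_ff.
  + by move=> x _; rewrite lee_fin; exact: f_nd.
by apply: nearW => l; rewrite -(fineK mfin); exact: Q3.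
Qed.

End fiberwise_bound.

(** * Approximation of continuous costs *)

Lemma countable_base_seq (T : topologicalType) : @second_countable T ->
  exists f : nat -> set T, (forall n, open (f n)) /\
    forall x A, nbhs x A -> exists n, f n x /\ f n `<=` A.
Proof.
move=> [B cB [oB bB]].
case/pfcard_geP : (cB) => [B0|[f]].
  exists (fun=> set0); split; first by move=> _; exact: open0.
  by move=> x A /bB[b []]; rewrite B0.
exists f; split; first by move=> n; apply: oB; exact: funS.
move=> x A /bB[b [Bb bx] bA].
have fs : set_surj [set: nat] B f by exact: surj.
by have [n _ nb] := fs _ Bb; exists n; rewrite nb.
Qed.

Lemma nat_ratio_between {R : realType} (r s : R) : 0 <= r -> r < s ->
  exists p n : nat, r < p%:R / n.+1%:R < s.
Proof.
move=> r0 rs; have sr : 0 < s - r by rewrite subr_gt0.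
pose n := Num.truncn (s - r)^-1.
have n1 : 1 < (s - r) * n.+1%:R.
  by rewrite -ltr_pdivrMl// mulr1 truncnS_gt.
pose p := (Num.truncn (r * n.+1%:R)).+1.
exists p, n; rewrite ltr_pdivlMr// ltr_pdivrMr// truncnS_gt/=.
have h : (Num.truncn (r * n.+1%:R))%:R <= r * n.+1%:R.
  by rewrite Num.Theory.truncn_le mulr_ge0.
rewrite /p -natr1 -[s](subrK r) mulrDl addrC.
exact: ltr_leD.
Qed.

Section rectangles.
Context {R : realType} {T1 T2 T3 : topologicalType}.
Hypothesis s1 : @second_countable T1.
Hypothesis s2 : @second_countable T2.
Hypothesis s3 : @second_countable T3.
Variable g : T1 * T2 * T3 -> R.
Hypothesis cg : continuous g.
Hypothesis g0 : forall x, 0 <= g x.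

(** The boxes come from countable bases, with rational heights, and those lying below [g] are kept.
    By continuity, any value strictly below [g] at a point is exceeded by the height of a kept box
    around it. *)
Lemma rectangles_below : exists (A : nat -> set T1) (B : nat -> set T2)
    (C : nat -> set T3) (q : nat -> R),
  [/\ forall n, [/\ open (A n), open (B n), open (C n) & 0 <= q n],
      forall n x y z, A n x -> B n y -> C n z -> q n <= g (x, y, z) &
      forall x y z r, 0 <= r < g (x, y, z) ->
        exists n, [/\ A n x, B n y, C n z & r < q n]].
Proof.
have [f1 [of1 b1]] := countable_base_seq s1.
have [f2 [of2 b2]] := countable_base_seq s2.
have [f3 [of3 b3]] := countable_base_seq s3.
pose good (t : nat * nat * nat * (nat * nat)) := forall x y z,
  f1 t.1.1.1 x -> f2 t.1.1.2 y -> f3 t.1.2 z ->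
  t.2.1%:R / t.2.2.+1%:R <= g (x, y, z).
(* Codes of nothing, or of a box that is not below [g], yield empty sets and height 0. *)
have /choice[D DP] : forall n : nat, exists D : set T1 * set T2 * set T3 * R,
    [/\ [/\ open D.1.1.1, open D.1.1.2, open D.1.2 & 0 <= D.2],
     forall x y z, D.1.1.1 x -> D.1.1.2 y -> D.1.2 z -> D.2 <= g (x, y, z) &
     forall t, unpickle n = Some t -> good t ->
       D = (f1 t.1.1.1, f2 t.1.1.2, f3 t.1.2, t.2.1%:R / t.2.2.+1%:R)].
  move=> n; case nE : (unpickle n) => [t|]; last first.
    by exists (set0, set0, set0, 0); split => //=; split => //; exact: open0.
  have [gt|ngt] := pselect (good t); last first.
    exists (set0, set0, set0, 0); split => [|//|t0 /Some_inj <- //].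
    by split => //; exact: open0.
  exists (f1 t.1.1.1, f2 t.1.1.2, f3 t.1.2, t.2.1%:R / t.2.2.+1%:R).
  split => [|//|t0 /Some_inj <- //].
  by split => //=; rewrite divr_ge0.
exists (fun n => (D n).1.1.1), (fun n => (D n).1.1.2), (fun n => (D n).1.2),
  (fun n => (D n).2); split.
- by move=> n; have [] := DP n.
- by move=> n; have [] := DP n.
move=> x y z r /andP[r0 rg].
have [p [m /andP[rp pg]]] := nat_ratio_between r0 rg.
have : \forall w \near (x, y, z), p%:R / m.+1%:R < g w.
  exact: (cvgr_gt (g (x, y, z)) (@cg (x, y, z)) _ pg).
move=> [[P Q] /= [[[P1 P2] /= [xP1 yP2] P12] zQ] PQ].
have [n1 [n1x n1P]] := b1 _ _ xP1.
have [n2 [n2y n2P]] := b2 _ _ yP2.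
have [n3 [n3z n3P]] := b3 _ _ zQ.
pose t := (n1, n2, n3, (p, m)).
have gt : good t.
  move=> x' y' z' /n1P ? /n2P ? /n3P ?; apply/ltW.
  by apply: (PQ (x', y', z')); split => //; exact: P12.
exists (pickle t); have [_ _ /(_ t)] := DP (pickle t).
by rewrite pickleK => -> // .
Qed.

End rectangles.

Lemma code_approximation {R : realType} (Y V U : ptopologicalType)
    (g : Y * V * U -> R) :
  @second_countable Y -> @second_countable V -> @second_countable U ->
  continuous g -> (forall x, 0 <= g x) ->
  exists (K : nat -> finType) (cY : forall k, borel Y -> K k)
    (cV : forall k, borel V -> K k) (cU : forall k, borel U -> K k)
    (F : forall k, K k -> K k -> K k -> R),
  [/\ [/\ forall k i, measurable (cY k @^-1` [set i]),
      forall k i, measurable (cV k @^-1` [set i]) &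
      forall k i, measurable (cU k @^-1` [set i])],
      forall k e i j, 0 <= @F k e i j,
      forall y v u, nondecreasing_seq (fun k => F k (cY k y) (cV k v) (cU k u)) &
      forall y v u, F k (cY k y) (cV k v) (cU k u) @[k --> \oo] --> g (y, v, u)].
Proof.
move=> s1 s2 s3 cg g0.
have [A [B [C [q [oq qle qgt]]]]] := rectangles_below s1 s2 s3 cg g0.
(* A point is coded by its memberships in the first [k] sets of a list. The three codes tell which
   of the first [k] boxes contain the triple, so the largest of their heights is a function of the
   codes. *)
pose K k : finType := {ffun 'I_k -> bool}.
pose cd (T : Type) (E : nat -> set T) k (t : T) : K k := [ffun n : 'I_k => t \in E n].
have mcd (T : ptopologicalType) (E : nat -> set T) k i : (forall n, open (E n)) ->
    measurable ((cd T E k : borel T -> K k) @^-1` [set i]).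
  move=> oE; rewrite (_ : _ @^-1` _ = \bigcap_(n in [set: 'I_k])
      (if i n then E n else ~` (E n))); last first.
    apply/seteqP; split=> t /=.
      move=> <- n _; rewrite /cd ffunE; case: ifPn; first by rewrite inE.
      by rewrite notin_setE.
    move=> h; apply/ffunP => n; rewrite ffunE; have := h n Logic.I.
    by case: (i n) => /= hn; [exact: mem_set|exact: memNset].
  apply: fin_bigcap_measurable => // n _.
  have mE : measurable (E n : set (borel T)) by exact: sub_sigma_algebra.
  by case: ifPn => // _; exact: measurableC.
pose F k (e i j : K k) : R :=
  \big[Num.max/0]_(n < k) (if [&& e n, i n & j n] then q n else 0).
pose Q y v u n := if [&& y \in A n, v \in B n & u \in C n] then q n else 0.
have FE k y v u : F k (cd _ A k y) (cd _ B k v) (cd _ C k u) =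
    \big[Num.max/0]_(n < k) Q y v u n.
  by rewrite /F; apply: eq_bigr => n _; rewrite !ffunE.
have q0 n : 0 <= q n by have [] := oq n.
have Fnd y v u : nondecreasing_seq (fun k => \big[Num.max/0]_(n < k) Q y v u n).
  by move=> k l kl; exact: (le_bigmax_ord xpredT (Q y v u) kl).
have Qg y v u n : Q y v u n <= g (y, v, u).
  rewrite /Q; case: ifPn => // /and3P[]; rewrite !inE => ? ? ?; exact: qle.
exists K, (cd _ A), (cd _ B), (cd _ C), F; split.
- by split => k i; apply: mcd => n; have [] := oq n.
- move=> k e i j; rewrite /F; elim/big_ind : _ => //.
    by move=> x y x0 _; rewrite le_max x0.
  by move=> n _; case: ifPn.
- by move=> y v u k l kl; rewrite !FE; exact: Fnd.
move=> y v u; under eq_fun do rewrite FE.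
have Mg k : \big[Num.max/0]_(n < k) Q y v u n <= g (y, v, u).
  by elim/big_ind : _ => // a b a0 b0; rewrite ge_max a0.
apply/cvgrPdist_lt => e e0.
(* [qgt] says nothing where [g] vanishes; there all the maxima are 0. *)
have [gy0|gy0] := leP (g (y, v, u)) 0.
  apply: nearW => k; rewrite (_ : \big[_/_]_(_ < _) _ = 0) ?subr0.
    by rewrite (_ : g _ = 0) ?normr0//; apply/eqP; rewrite eq_le gy0 g0.
  apply/eqP; rewrite eq_le (le_trans (Mg k) gy0)/=.
  by have := Fnd y v u _ _ (leq0n k); rewrite big_ord0.
have [|n [An Bn Cn rq]] := qgt y v u (Num.max 0 (g (y, v, u) - e)).
  by rewrite le_max lexx/= gt_max gy0/= ltrBlDr ltrDl.
exists n.+1 => // k /= nk.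
rewrite ger0_norm; last by rewrite subr_ge0 Mg.
rewrite ltrBlDr -ltrBlDl.
have h : q n <= \big[Num.max/0]_(i < k) Q y v u i.
  apply: le_trans (Fnd y v u _ _ nk).
  by apply: le_trans (le_bigmax _ _ ord_max); rewrite /Q/= !mem_set.
rewrite (lt_le_trans _ h)// (le_lt_trans _ rq)//.
by rewrite le_max lexx orbT.
Qed.

(** * The constrained problem *)

(** The positive part of [f] may have infinite integral, but the negative part is at most [B], so
    its integral is finite and can be moved across. *)
Lemma integral_shift {d} {T : measurableType d} {R : realType}
    (P : probability T R) (f : T -> R) (B : R) : 0 <= B ->
  measurable_fun [set: T] f -> (forall x, - B <= f x) ->
  (\int[P]_x (f x + B)%:E = \int[P]_x (f x)%:E + B%:E)%E.
Proof.
move=> B0 mf fB; pose F x := (f x)%:E.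
have mF : measurable_fun setT F by exact/measurable_EFinP.
have FnE x : (F^\- x = (Num.max (- f x) 0)%:E)%E by rewrite funenegE -EFinN -EFin_max.
have FpE x : (F^\+ x = (Num.max (f x) 0)%:E)%E by rewrite funeposE -EFin_max.
have FnB x : (F^\- x <= B%:E)%E by rewrite FnE lee_fin ge_max B0 andbT lerNl.
have mFn : measurable_fun setT (F^\-)%E by exact: measurable_funeneg.
have mBFn : measurable_fun setT (fun x => B%:E - F^\- x)%E by exact: emeasurable_funB.
have BFn0 x : (0 <= B%:E - F^\- x)%E.
  by have := FnB x; rewrite FnE -EFinB !lee_fin subr_ge0.
have zw : (\int[P]_x (B%:E - F^\- x) + \int[P]_x F^\- x = B%:E)%E.
  rewrite -ge0_integralD// (eq_integral (cst B%:E)); last first.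
    by move=> x _; rewrite FnE subeK.
  by rewrite integral_cst//= [X in (_ * X)%E](probability_setT P) mule1.
have w0 : (0 <= \int[P]_x F^\- x)%E by exact: integral_ge0.
have z0 : (0 <= \int[P]_x (B%:E - F^\- x))%E by exact: integral_ge0.
have wfin : (\int[P]_x F^\- x)%E \is a fin_num.
  rewrite ge0_fin_numE// (@le_lt_trans _ _ B%:E) ?ltry//.
  by rewrite -zw leeDr.
rewrite (eq_integral (fun x => F^\+ x + (B%:E - F^\- x)))%E; last first.
  move=> x _; rewrite FnE FpE -EFinB -EFinD; congr _%:E.
  by rewrite !/Num.max; case: ltP => h1; case: ltP => h2; lra.
rewrite ge0_integralD//; last exact: measurable_funepos.
have -> : (\int[P]_x (f x)%:E = \int[P]_x F^\+ x - \int[P]_x F^\- x)%E.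
  exact: (integralE _ _ F).
rewrite -addeA; congr (_ + _)%E.
set z := (\int[P]_x _)%E in zw *.
by rewrite -zw [RHS]addeC addeK.
Qed.

(** The integrals agree on every measurable [E]: a strict inequality on [E], added to the inequality
    on its complement, would contradict the comparison of the totals. Finiteness permits the
    subtraction. *)
Lemma ae_eq_of_le_integral {d} {T : measurableType d} {R : realType}
    (mu : {measure set T -> \bar R}) (f g : T -> \bar R) :
  measurable_fun [set: T] f -> measurable_fun [set: T] g ->
  (forall x, 0 <= f x)%E -> (forall x, 0 <= g x)%E ->
  {ae mu, forall x, (g x <= f x)%E} ->
  (\int[mu]_x f x <= \int[mu]_x g x)%E -> (\int[mu]_x g x < +oo)%E ->
  {ae mu, forall x, f x = g x}.
Proof.
move=> mf mg f0 g0 gf fg goo.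
have foo := le_lt_trans fg goo.
have int h : measurable_fun [set: T] h -> (forall x, 0 <= h x)%E ->
    (\int[mu]_x h x < +oo)%E -> mu.-integrable setT h.
  move=> mh h0 hoo; apply/integrableP; split=> //.
  by under eq_integral do rewrite gee0_abs//.
have leE E : measurable E -> (\int[mu]_(x in E) g x <= \int[mu]_(x in E) f x)%E.
  move=> mE; apply: ae_ge0_le_integral => //; try exact: measurable_funTS.
  by apply: filterS gf => x h _.
have split h E : measurable_fun [set: T] h -> (forall x, 0 <= h x)%E ->
    measurable E ->
    (\int[mu]_x h x = \int[mu]_(x in E) h x + \int[mu]_(x in ~` E) h x)%E.
  move=> mh h0 mE; rewrite -ge0_integral_setU//.
  - by rewrite setUv.
  - exact: measurableC.
  - by rewrite setUv.
  - by rewrite disj_set2E setICr.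
have sub h E : measurable_fun [set: T] h -> (forall x, 0 <= h x)%E ->
    (\int[mu]_x h x < +oo)%E -> measurable E ->
    (\int[mu]_(x in E) h x)%E \is a fin_num.
  move=> mh h0 hoo mE; rewrite ge0_fin_numE ?integral_ge0//.
  by rewrite (le_lt_trans _ hoo)//; exact: ge0_subset_integral.
have : ae_eq mu setT f g.
  apply: integral_ae_eq => //; first exact: int.
  move=> E _ mE; apply/eqP; rewrite eq_le leE// andbT.
  have mEC : measurable (~` E) by exact: measurableC.
  have := fg; rewrite (split f E)// (split g E)//.
  have := leE _ mEC.
  have /fineK <- := sub f E mf f0 foo mE.
  have /fineK <- := sub g E mg g0 goo mE.
  have /fineK <- := sub f _ mf f0 foo mEC.
  have /fineK <- := sub g _ mg g0 goo mEC.
  rewrite -!EFinD !lee_fin; lra.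
by apply: filterS => x; apply.
Qed.

(** For a single [A] the exceptional null set depends on [A]. Preimages of cylinders under [b] are
    countably many and determine a probability, so one null set serves all [A]. *)
Lemma standard_kernel_ae_eq {dY dT} {Y : measurableType dY}
    {T : measurableType dT} {R : realType} (mu : probability Y R)
    (k1 k2 : Y -> probability T R) : standard T ->
  (forall A, measurable A -> measurable_fun [set: Y] (k1 ^~ A)) ->
  (forall A, measurable A -> measurable_fun [set: Y] (k2 ^~ A)) ->
  (forall A D, measurable A -> measurable D ->
    (\int[mu]_(y in D) k1 y A = \int[mu]_(y in D) k2 y A)%E) ->
  {ae mu, forall y, forall A, measurable A -> k1 y A = k2 y A}.
Proof.
move=> [b [r [mb mr bK]]] mk1 mk2 k12.
have mC s : measurable (b @^-1` cyl s).
  by rewrite -[X in measurable X]setTI; apply: mb => //; exact: measurable_cyl.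
have ae1 A : measurable A -> {ae mu, forall y, k1 y A = k2 y A}.
  move=> mA; have : ae_eq mu setT (k1 ^~ A) (k2 ^~ A).
    apply: integral_ae_eq => //; [|exact: mk2|by move=> E _ mE; exact: k12].
    apply/integrableP; split; first exact: mk1.
    apply: (@le_lt_trans _ _ (\int[mu]_y (cst 1 y))%E).
      apply: ge0_le_integral => //.
      - by apply: measurableT_comp => //; exact: mk1.
      - by move=> y _; rewrite gee0_abs//; exact: probability_le1.
    by rewrite integral_cst// mul1e (le_lt_trans (probability_le1 mu measurableT))// ltry.
  by apply: filterS => x; apply.
have : {ae mu, forall y, forall n, forall s : seq bool, unpickle n = Some s ->
    k1 y (b @^-1` cyl s) = k2 y (b @^-1` cyl s)}.
  apply: ae_foralln => n; case nE : (unpickle n) => [s|]; last exact: aeW.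
  by apply: filterS (ae1 _ (mC s)) => y ? ? [<-].
apply: filterS => y ky A mA.
have h C : measurable C -> law (k1 y) mb C = law (k2 y) mb C.
  apply: (@eq_finite_measure _ cantor _ cylinders) => //.
  - exact: setI_cylinders.
  - rewrite (_ : _ setT = 1%E) ?ltry//; exact: (probability_setT (law (k1 y) mb)).
  - by rewrite [LHS](probability_setT (law (k1 y) mb)) [RHS](probability_setT (law (k2 y) mb)).
  - move=> _ [->|[s ->]]; first by rewrite !measure0.
    by apply: (ky (pickle s)); rewrite pickleK.
have -> : A = b @^-1` (r @^-1` A) by apply/seteqP; split=> x /=; rewrite bK.
apply: h; rewrite -[X in measurable X]setTI; exact: mr.
Qed.

Lemma measurable_borel4_continuous {R : realType} (T1 T2 T3 T4 : ptopologicalType)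
    (c : (T1 * T2) * (T3 * T4) -> R) :
  @second_countable T1 -> @second_countable T2 ->
  @second_countable T3 -> @second_countable T4 -> continuous c ->
  measurable_fun [set: (borel T1 * borel T2) * (borel T3 * borel T4)] c.
Proof.
move=> s1 s2 s3 s4 cc mT; apply: (measurability _ (RGenOInfty.measurableE R)) => //.
move=> _ [_ [r ->] <-]; rewrite setTI measurable_borel4//.
apply: preimage_borel; first exact: cc.
by apply: sub_sigma_algebra; exact: rray_open.
Qed.

(** By Hausdorff separation, distinct points lie in disjoint basic open sets, and there are
    countably many pairs of these. *)
Lemma measurable_neq {dT} {T : measurableType dT} (Y : ptopologicalType)
    (f1 f2 : T -> borel Y) : @second_countable Y -> hausdorff_space Y ->
  measurable_fun [set: T] f1 -> measurable_fun [set: T] f2 ->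
  measurable [set x | f1 x <> f2 x].
Proof.
move=> sY hY mf1 mf2; have [b [ob bP]] := countable_base_seq sY.
have mb n : measurable (b n : set (borel Y)) by exact: sub_sigma_algebra.
rewrite (_ : [set x | _] = \bigcup_n \bigcup_k
  (if pselect (b n `&` b k = set0) then f1 @^-1` b n `&` f2 @^-1` b k else set0)).
  apply: bigcupT_measurable => n; apply: bigcupT_measurable => k.
  case: pselect => //= _; apply: measurableI.
    by rewrite -[X in measurable X]setTI; exact: mf1.
  by rewrite -[X in measurable X]setTI; exact: mf2.
apply/seteqP; split=> x /=.
  move=> /eqP f12; move: hY; rewrite open_hausdorff => /(_ _ _ f12).
  move=> [[A B] /= [Ax Bx] [oA oB AB]].
  rewrite !inE in Ax Bx.
  have [n [nx nA]] := bP _ _ (open_nbhs_nbhs (conj oA Ax)).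
  have [k [kx kB]] := bP _ _ (open_nbhs_nbhs (conj oB Bx)).
  exists n => //; exists k => //; case: pselect => // -[].
  by apply/seteqP; split=> z // [/nA ? /kB ?]; rewrite -(eqP AB).
move=> [n _ [k _]]; case: pselect => //= nk [f1n f2k] f12.
by rewrite -[False]/(set0 (f1 x)) -nk; split=> //; rewrite f12.
Qed.

Lemma ae_eq_measure {d} {T : measurableType d} {R : realType}
    (P : {measure set T -> \bar R}) (A B : set T) :
  measurable A -> measurable B -> {ae P, forall x, A x <-> B x} -> P A = P B.
Proof.
move=> mA mB AB; rewrite -[A]setIT -[B]setIT -!integral_indic//.
apply: ge0_ae_eq_integral => //.
- by apply/measurable_EFinP; exact: measurable_indic.
- by apply/measurable_EFinP; exact: measurable_indic.
- apply: filterS AB => x ABx _; rewrite !indicE; congr (_%:R%:E).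
  by congr (nat_of_bool _); apply/idP/idP; rewrite !inE => /ABx.
Qed.

(** * Disintegration of constrained couplings along [y] *)

Section constrained.
Context {dY dV dU} {Y : measurableType dY} {V : measurableType dV}
  {U : measurableType dU} {R : realType}.
Variables (nu : probability (Y * U)%type R) (etaV : probability V R).
Let nuY : probability Y R := distribution nu fst.
Let eta : probability (Y * V)%type R := (nuY \x etaV)%E.
Let X4 := ((Y * V) * (Y * U))%type.

Let my : measurable_fun [set: X4] (fun x => x.2.1).
Proof. exact: measurableT_comp measurable_fst measurable_snd. Qed.
Let mz : measurable_fun [set: X4] (fun x => x.1.1).
Proof. exact: measurableT_comp measurable_fst measurable_fst. Qed.
Let mv : measurable_fun [set: X4] (fun x => x.1.2).
Proof. exact: measurableT_comp measurable_snd measurable_fst. Qed.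
Let mu : measurable_fun [set: X4] (fun x => x.2.2).
Proof. exact: measurableT_comp measurable_snd measurable_snd. Qed.
Let mvu : measurable_fun [set: X4] (fun x => (x.1.2, x.2.2)).
Proof. exact: measurable_fun_pair. Qed.

Lemma measurable_diagonal_point :
  measurable_fun [set: Y * (V * U)] (fun x => ((x.1, x.2.1), (x.1, x.2.2))).
Proof.
have m2 : measurable_fun [set: Y * (V * U)] (fun x => x.2.1).
  exact: measurableT_comp measurable_fst measurable_snd.
have m3 : measurable_fun [set: Y * (V * U)] (fun x => x.2.2).
  exact: measurableT_comp measurable_snd measurable_snd.
by apply: measurable_fun_pair; apply: measurable_fun_pair.
Qed.

Section disintegration.
Variable pi : probability ((Y * V) * (Y * U))%type R.
Hypothesis pi_constrained : constrained_couplings eta nu pi.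

Let pi_fst A : measurable A -> pi (fst @^-1` A) = eta A.
Proof. by have [[+ _] _] := pi_constrained; apply. Qed.
Let pi_snd B : measurable B -> pi (snd @^-1` B) = nu B.
Proof. by have [[_ +] _] := pi_constrained; apply. Qed.
Let pi_diag : {ae pi, forall x, x.1.1 = x.2.1}.
Proof. by have [] := pi_constrained. Qed.

Lemma constrained_lawE D : measurable D -> law pi my D = nuY D.
Proof.
move=> mD; rewrite -[LHS]/(pi (snd @^-1` (fst @^-1` D))) pi_snd//.
by rewrite -[X in measurable X]setTI; exact: measurable_fst.
Qed.

Variable gamma : Y -> probability (V * U)%type R.
Hypothesis gammaP :
  is_cond_law pi (fun x => x.2.1) (fun x => (x.1.2, x.2.2)) gamma.

(** Almost surely [z] equals [y], so [y] may be copied into the place of [z] in [f]; only [y] and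
    the pair [(v, u)] are then left to disintegrate. *)
Lemma integral_constrained (f : (Y * V) * (Y * U) -> \bar R) :
  measurable_fun setT f -> (forall x, (0 <= f x)%E) ->
  (\int[pi]_x f x =
   \int[nuY]_y \int[gamma y]_w f ((y, w.1), (y, w.2)))%E.
Proof.
move=> mf f0.
pose h (x : Y * (V * U)) := f ((x.1, x.2.1), (x.1, x.2.2)).
have mh : measurable_fun setT h.
  exact: measurableT_comp mf measurable_diagonal_point.
transitivity (\int[pi]_x h (x.2.1, (x.1.2, x.2.2)))%E.
  apply: ge0_ae_eq_integral => //.
  - by apply: measurableT_comp mh _; exact: measurable_fun_pair.
  - by move=> x _; exact: f0.
  - apply: filterS pi_diag => -[[z v] [y u]] /= zy _; by rewrite /h/= zy.
have h0 x : (0 <= h x)%E by exact: f0.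
rewrite (integral_cond_law my mvu gammaP mh h0).
apply: (@eq_measure_integral _ _ _ _ nuY (law pi my)) => A mA _.
exact: constrained_lawE.
Qed.

(** The product with the Dirac mass gives [B] the mass [gamma y (xsection B y)], which is what
    [integral_constrained] yields for indicators. *)
Lemma diag_cond_law :
  is_cond_law pi (fun x => x.2.1) (fun x => (x.1.1, (x.1.2, x.2.2)))
    (fun y => (\d_y \x gamma y)%E).
Proof.
have dE y B : measurable B -> (\d_y \x gamma y)%E B = gamma y (xsection B y).
  move=> mB; rewrite /product_measure1 integral_dirac//.
    by rewrite diracT mul1e.
  exact: measurable_fun_xsection.
split.
  move=> B mB; apply: (eq_measurable_fun (fun y => gamma y (xsection B y))).
    by move=> y _; exact/esym/dE.
  exact: (measurable_cond_law_xsection gammaP).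
move=> A B mA mB.
have mZ : measurable_fun [set: X4] (fun x => (x.1.1, (x.1.2, x.2.2))).
  exact: measurable_fun_pair.
have mAB : measurable ((fun x : X4 => x.2.1) @^-1` A `&`
    (fun x : X4 => (x.1.1, (x.1.2, x.2.2))) @^-1` B).
  apply: measurableI.
    by rewrite -[X in measurable X]setTI; exact: my.
  by rewrite -[X in measurable X]setTI; exact: mZ.
have mE : measurable_fun setT (fun x => (\1_((fun x : X4 => x.2.1) @^-1` A `&`
    (fun x : X4 => (x.1.1, (x.1.2, x.2.2))) @^-1` B) x)%:E : \bar R).
  by apply/measurable_EFinP; exact: measurable_indic.
rewrite -[X in pi X]setIT -integral_indic//.
rewrite (integral_constrained mE); last by move=> x; rewrite lee_fin.
rewrite [RHS](@eq_measure_integral _ _ _ A nuY (law pi my)); last first.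
  by move=> C mC _; exact: constrained_lawE.
rewrite [RHS]integral_mkcond; apply: eq_integral => y _.
rewrite patchE; case: ifPn => yA; last first.
  rewrite integral0_eq// => w _; rewrite indicE memNset//= => -[yA' _].
  by move: yA; rewrite notin_setE.
transitivity (gamma y (xsection B y)); last exact/esym/dE.
rewrite -[X in gamma y X]setIT -integral_indic//; last exact: measurable_xsection.
apply: eq_integral => -[v u] _; rewrite !indicE mem_xsection; congr (_%:R%:E).
congr nat_of_bool; apply/idP/idP => [/set_mem[_ ?]|/set_mem ?]; apply/mem_set => //.
by split => //; exact: set_mem yA.
Qed.

(** Since [z = y] almost surely and [eta] is a product, [(y, v)] has a product law, so the law of
    [v] given [y] is the constant kernel [etaV]; that of [u] is read from [nu]. Almost everywhere
    uniqueness of kernels identifies both. *)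
Lemma fiber_couplings (kap : Y -> probability U R) :
  standard V -> standard U -> is_cond_law nu fst snd kap ->
  {ae nuY, forall y, couplings etaV (kap y) (gamma y)}.
Proof.
move=> stV stU [mkap kapE].
have mfst A : measurable A -> measurable ((fst : V * U -> V) @^-1` A).
  by move=> mA; rewrite -[X in measurable X]setTI; exact: measurable_fst.
have msnd A : measurable A -> measurable ((snd : V * U -> U) @^-1` A).
  by move=> mA; rewrite -[X in measurable X]setTI; exact: measurable_snd.
have gE B D : measurable B -> measurable D ->
    (\int[nuY]_(y in D) gamma y B =
     pi ((fun x => x.2.1) @^-1` D `&` (fun x => (x.1.2, x.2.2)) @^-1` B))%E.
  move=> mB mD; rewrite gammaP.2//; apply: (eq_measure_integral (law pi my)).
  by move=> C mC _; exact/esym/constrained_lawE.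
have ae1 : {ae nuY, forall y, forall A, measurable A ->
    law (gamma y) measurable_fst A = etaV A}.
  apply: (@standard_kernel_ae_eq _ _ _ _ _ nuY
    (fun y => law (gamma y) measurable_fst) (fun=> etaV)) => //.
  - by move=> A mA; apply: gammaP.1; exact: mfst.
  move=> A D mA mD; rewrite gE//; last exact: mfst.
  rewrite integral_cst// muleC -(product_measure1E nuY etaV)//.
  rewrite -(pi_fst (measurableX mD mA)); apply: ae_eq_measure.
  - apply: measurableI; first by rewrite -[X in measurable X]setTI; exact: my.
    by rewrite -[X in measurable X]setTI; apply: mvu => //; exact: mfst.
  - by rewrite -[X in measurable X]setTI; apply: measurable_fst => //; exact: measurableX.
  by apply: filterS pi_diag => -[[z v] [y u]] /= ->.
have ae2 : {ae nuY, forall y, forall A, measurable A ->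
    law (gamma y) measurable_snd A = kap y A}.
  apply: (@standard_kernel_ae_eq _ _ _ _ _ nuY
    (fun y => law (gamma y) measurable_snd) kap) => //.
  - by move=> A mA; apply: gammaP.1; exact: msnd.
  move=> A D mA mD; rewrite gE//; last exact: msnd.
  rewrite -[RHS]/(\int[pushforward nu fst]_(y in D) kap y A)%E -kapE//.
  rewrite -pi_snd//; apply: measurableI.
    by rewrite -[X in measurable X]setTI; exact: measurable_fst.
  by rewrite -[X in measurable X]setTI; exact: measurable_snd.
by apply: filterS2 ae1 ae2 => y h1 h2; split=> A mA; [exact: h1|exact: h2].
Qed.

End disintegration.

(** Copying [y] into the place of [z] makes the constraint hold everywhere, and the condition on
    rectangles forces the first marginal to be the product measure. *)
Lemma exists_constrained (Q : probability ((Y * U) * V)%type R) :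
  measurable [set x : (Y * V) * (Y * U) | x.1.1 <> x.2.1] ->
  (forall B, measurable B -> Q (B `*` setT) = nu B) ->
  (forall B A, measurable B -> measurable A ->
    Q ((B `*` setT) `*` A) = (nuY B * etaV A)%E) ->
  exists2 pi, constrained_couplings eta nu pi &
    forall f : (Y * V) * (Y * U) -> \bar R, measurable_fun setT f ->
      (forall x, (0 <= f x)%E) ->
      (\int[pi]_x f x = \int[Q]_x f ((x.1.1, x.2), (x.1.1, x.1.2)))%E.
Proof.
move=> mdiag Q1 Q2.
pose phi (x : (Y * U) * V) := ((x.1.1, x.2), (x.1.1, x.1.2)).
have mphi0 : measurable_fun setT (fun x : (Y * U) * V => (x.1.1, x.2)).
  apply: measurable_fun_pair => //.
  exact: measurableT_comp measurable_fst measurable_fst.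
have mphi : measurable_fun setT phi.
  apply: measurable_fun_pair => //; apply: measurable_fun_pair.
    exact: measurableT_comp measurable_fst measurable_fst.
  exact: measurableT_comp measurable_snd measurable_fst.
exists (law Q mphi).
  split; first split.
  - move=> A mA; rewrite -[LHS]/(law Q mphi0 A).
    apply/esym; apply: (@product_measure_unique _ _ _ _ _ nuY etaV (law Q mphi0)) => // B C mB mC.
    rewrite -Q2// -[LHS]/(Q (_ @^-1` _)); congr (Q _).
    by apply/seteqP; split=> -[[y u] v] /=; [case|case; case].
  - move=> B mB; rewrite -Q1// -[LHS]/(Q (_ @^-1` _)); congr (Q _).
    by apply/seteqP; split=> -[[y u] v] /=; [|case].
  apply/negligibleP; first exact: mdiag.
  rewrite -[LHS]/(Q (_ @^-1` _)) (_ : _ @^-1` _ = set0) ?measure0//.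
  by apply/seteqP; split=> x // /=.
by move=> f mf f0; rewrite /law /distribution ge0_integral_pushforward//= preimage_setT.
Qed.

End constrained.

Theorem theorem1p5 (R : realType) (Y U V : completeNormedModType R)
    (hY : is_hilbert Y) (sY : separable Y)
    (hU : is_hilbert U) (sU : separable U)
    (hV : is_hilbert V) (sV : separable V)
    (nu : probability (borel Y * borel U)%type R)
    (etaV : probability (borel V) R)
    (c : (Y * V) * (Y * U) -> R)
    (c_cont : continuous c)
    (c_bounded : (-oo < ereal_inf (range (EFin \o c)))%E) :
  let nuY : probability (borel Y) R := distribution nu fst in
  let eta : probability (borel Y * borel V)%type R := (nuY \x etaV)%E in
  let K (pi : probability ((borel Y * borel V) * (borel Y * borel U))%type R) :=
    (\int[pi]_x (c x)%:E)%E in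
  ereal_inf (K @` constrained_couplings eta nu) \is a fin_num ->
  (exists pi, is_minimizer (constrained_couplings eta nu) K pi) /\
  (forall pi, is_minimizer (constrained_couplings eta nu) K pi ->
    exists gamma : borel Y -> probability (borel V * borel U)%type R,
    [/\ is_cond_law pi (fun x => x.2.1) (fun x => (x.1.2, x.2.2)) gamma,
        is_cond_law pi (fun x => x.2.1) (fun x => (x.1.1, (x.1.2, x.2.2)))
          (fun y => (\d_y \x gamma y)%E) &
        forall nucond : borel Y -> probability (borel U) R,
          is_cond_law nu fst snd nucond ->
          {ae nuY, forall y,
            is_minimizer (couplings etaV (nucond y))
              (fun p => (\int[p]_w (c ((y, w.1), (y, w.2)))%:E)%E)
              (gamma y)}]).
Proof.
move=> nuY eta K Kfin.
have cY2 := separable_second_countable sY.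
have cU2 := separable_second_countable sU.
have cV2 := separable_second_countable sV.
have stU : standard (borel U) := standard_borel sU.
have stV : standard (borel V) := standard_borel sV.
(* The infimum cannot be infinite, as evaluation of [c] at the origin shows. *)
have [B B0 cB] : exists2 B : R, 0 <= B & forall x, - B <= c x.
  have lb x : (ereal_inf (range (EFin \o c)) <= (c x)%:E)%E.
    by apply: ereal_inf_lbound; exists x.
  move: c_bounded lb; case: ereal_inf => [r _ lb|_ lb|//].
    exists (Num.max 0 (- r)); first by rewrite le_max lexx.
    move=> x; rewrite (le_trans _ (lb x : r <= c x))//.
    by rewrite lerNl le_max lexx orbT.
  by have := lb ((0, 0), (0, 0)); rewrite leye_eq.
have mc : measurable_fun
    [set: (borel Y * borel V) * (borel Y * borel U)] c.
  exact: measurable_borel4_continuous.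
(* From here [c + B] replaces [c], because the disintegration formulas are for nonnegative
   functions; [KE] and [JE] translate back. *)
pose f (x : (borel Y * borel V) * (borel Y * borel U)) : \bar R := (c x + B)%:E.
have f0 x : (0 <= f x)%E by rewrite lee_fin -[B]opprK subr_ge0.
have mf : measurable_fun setT f.
  by apply/measurable_EFinP; exact: measurable_funD.
have KE (pi : probability ((borel Y * borel V) * (borel Y * borel U))%type R) :
    (\int[pi]_x f x = K pi + B%:E)%E by exact: integral_shift.
pose diag (y : borel Y) (w : borel V * borel U) :=
  ((y, w.1), (y, w.2)) : (borel Y * borel V) * (borel Y * borel U).
have mdiag : measurable_fun setT
    (fun x : borel Y * (borel V * borel U) => diag x.1 x.2).
  exact: measurable_diagonal_point.
have mdiag1 y : measurable_fun setT (diag y).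
  exact: measurableT_comp mdiag (measurable_pair1 y).
have JE y (p : probability (borel V * borel U)%type R) :
    (\int[p]_w f (diag y w) = \int[p]_w (c (diag y w))%:E + B%:E)%E.
  apply: (@integral_shift _ _ _ _ (c \o diag y)) => // [|w]; last exact: cB.
  exact: measurableT_comp mc (mdiag1 y).
have mneq : measurable [set x : (borel Y * borel V) * (borel Y * borel U) |
    x.1.1 <> x.2.1].
  apply: (@measurable_neq _ _ Y) => //.
  - exact: measurableT_comp measurable_fst measurable_fst.
  - exact: measurableT_comp measurable_fst measurable_snd.
pose g (x : Y * V * U) : R := c ((x.1.1, x.1.2), (x.1.1, x.2)) + B.
have cg : continuous g.
  move=> x; apply: cvgD; last exact: cvg_cst.
  apply: (@continuous_comp _ _ _
    (fun x : Y * V * U => ((x.1.1, x.1.2), (x.1.1, x.2))) c); last exact: c_cont.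
  have h1 : {for x, continuous (fun x : Y * V * U => x.1.1)}.
    by apply: (@continuous_comp _ _ _ fst fst); exact: cvg_fst.
  have h2 : {for x, continuous (fun x : Y * V * U => x.1.2)}.
    by apply: (@continuous_comp _ _ _ fst snd); [exact: cvg_fst|exact: cvg_snd].
  have h3 : {for x, continuous (fun x : Y * V * U => x.2)} by exact: cvg_snd.
  exact: (cvg_pair (cvg_pair h1 h2) (cvg_pair h1 h3)).
have g0 x : 0 <= g x by rewrite /g -[B]opprK subr_ge0.
have [E [cdY [cdV [cdU [F [[mcY mcV mcU] F0 Fnd Fcvg]]]]]] :=
  code_approximation cY2 cV2 cU2 cg g0.
have bound kap (kapP : is_cond_law nu fst snd kap) :=
  @fiberwise_bound _ _ _ (borel Y) (borel U) (borel V) R nu etaV kap kapP stV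
    E cdY cdV cdU mcY mcV mcU F F0 (fun y v u => g (y, v, u)) Fnd Fcvg.
have my : measurable_fun [set: (borel Y * borel V) * (borel Y * borel U)]
    (fun x => x.2.1).
  exact: measurableT_comp measurable_fst measurable_snd.
have mvu : measurable_fun [set: (borel Y * borel V) * (borel Y * borel U)]
    (fun x => (x.1.2, x.2.2)).
  apply: measurable_fun_pair.
    exact: measurableT_comp measurable_snd measurable_fst.
  exact: measurableT_comp measurable_snd measurable_snd.
have disint (pi : probability ((borel Y * borel V) * (borel Y * borel U))%type R) :
    exists gamma : borel Y -> probability (borel V * borel U)%type R,
    is_cond_law pi (fun x => x.2.1) (fun x => (x.1.2, x.2.2)) gamma.
  exact: exists_cond_law my mvu (standard_prod stV stU).
pose J (gamma : borel Y -> probability (borel V * borel U)%type R) y :=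
  (\int[gamma y]_w f (diag y w))%E.
have mJ (pi : probability ((borel Y * borel V) * (borel Y * borel U))%type R) gamma :
    is_cond_law pi (fun x => x.2.1) (fun x => (x.1.2, x.2.2)) gamma ->
    measurable_fun setT (J gamma).
  move=> gammaP.
  apply: (measurable_cond_law_integral gammaP (h := fun x => f (diag x.1 x.2))).
    exact: measurableT_comp mf mdiag.
  by move=> x; exact: f0.
have J0 : forall gamma z, (0 <= J gamma z)%E.
  by move=> gamma z; apply: integral_ge0 => w _; exact: f0.
(* [m] is the fiberwise lower bound of [fiberwise_bound]; the integral of [m]
   is both a lower bound of the problem and attained. *)
have main kap : is_cond_law nu fst snd kap -> exists m : borel Y -> \bar R,
    [/\ measurable_fun setT m, forall y, (0 <= m y)%E,
     forall y p, couplings etaV (kap y) p -> (m y <= \int[p]_w f (diag y w))%E,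
     forall pi, constrained_couplings eta nu pi ->
       (\int[nuY]_y m y <= \int[pi]_x f x)%E &
     (\int[nuY]_y m y < +oo)%E -> exists2 pi, constrained_couplings eta nu pi &
       (\int[pi]_x f x <= \int[nuY]_y m y)%E].
  move=> kapP; have [m [mm m0 mle mQ]] := bound kap kapP.
  exists m; split=> //.
    move=> pi piS; have [gamma gammaP] := disint pi.
    rewrite (integral_constrained piS gammaP mf f0).
    apply: ae_ge0_le_integral => //.
    - by move=> y _; apply: integral_ge0 => w _; exact: f0.
    - exact: (mJ pi gamma gammaP).
    by apply: filterS (fiber_couplings piS gammaP stV stU kapP) => y cy _;
      exact: mle.
  move=> moo; have [Q [Q1 Q2 Q3]] := mQ moo.
  have [pi piS piE] := exists_constrained mneq Q1 Q2.
  by exists pi => //; rewrite piE.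
have inf_lb pi : constrained_couplings eta nu pi ->
    (ereal_inf (K @` constrained_couplings eta nu) <= K pi)%E.
  by move=> piS; apply: ereal_inf_lbound; exists pi.
have leK (pi pi' : probability ((borel Y * borel V) * (borel Y * borel U))%type R) :
    (\int[pi]_x f x <= \int[pi']_x f x)%E -> (K pi <= K pi')%E.
  by rewrite !KE leeD2rE.
split.
  have [kap kapP] := exists_cond_law nu measurable_fst measurable_snd stU.
  have [m [mm m0 _ mlb matt]] := main kap kapP.
  (* A finite infimum provides a coupling of finite cost, which makes the integral of [m] finite. *)
  have : (ereal_inf (K @` constrained_couplings eta nu) < +oo)%E.
    by rewrite ltey_eq Kfin.
  move=> /ereal_inf_lt[_ [pi0 pi0S <-] pi0oo].
  have [|pi piS pim] := matt.
    by rewrite (le_lt_trans (mlb _ pi0S))// KE lte_add_pinfty// ltry.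
  exists pi; split=> //; apply/eqP; rewrite eq_le inf_lb// andbT.
  apply: le_ereal_inf_tmp => _ [pi' pi'S <-]; apply: leK.
  exact: le_trans pim (mlb _ pi'S).
move=> pi [piS piE]; have [gamma gammaP] := disint pi.
exists gamma; split=> //; first exact: (diag_cond_law piS gammaP).
(* [m] is built anew for the given version [kap] of the conditional law, while [gamma] was fixed
   before [kap]. *)
move=> kap kapP; have [m [mm m0 mfib mlb matt]] := main kap kapP.
have piJ : (\int[pi]_x f x = \int[nuY]_y J gamma y)%E.
  exact: (integral_constrained piS gammaP mf f0).
have pioo : (\int[pi]_x f x < +oo)%E.
  by rewrite KE piE lte_add_pinfty ?ltry// ltey_eq Kfin.
have moo : (\int[nuY]_y m y < +oo)%E by exact: le_lt_trans (mlb _ piS) pioo.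
have [pi1 pi1S pi1m] := matt moo.
(* Minimality of [pi] is used against the single competitor [pi1], whose shifted cost is at most the
   integral of [m]. *)
have Jm : (\int[nuY]_y J gamma y <= \int[nuY]_y m y)%E.
  by rewrite -piJ (le_trans _ pi1m)// !KE leeD2rE// piE inf_lb.
have cpl := fiber_couplings piS gammaP stV stU kapP.
have mleJ : {ae nuY, forall y, (m y <= J gamma y)%E}.
  by apply: filterS cpl => y; exact: mfib.
have JEm := ae_eq_of_le_integral (mJ _ _ gammaP) mm (J0 gamma) m0 mleJ Jm moo.
apply: filterS2 cpl JEm => y ycpl yJ; split=> //.
(* Where [J gamma] equals [m], the measure [gamma y] attains a bound valid for every coupling of the
   fiber. *)
apply/eqP; rewrite eq_le; apply/andP; split.
  apply: le_ereal_inf_tmp => _ [p pcpl <-].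
  by have := mfib y p pcpl; rewrite -yJ /J !JE leeD2rE.
by apply: ereal_inf_lbound; exists (gamma y).
Qed.
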